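(* Let $\nu \in \mathcal{M}^{\rm int}(\mathbb{R}^n)$. Then: (i) $\nu$ is universal on $\mathcal{M}^{\rm int}_{\rm sym}(A_{[n]})$ if and only if $\delta_J \ast \nu_{[n]} \neq 0$ for all $J \subset [n]$ with $|J|$ even. (ii) $\nu$ is universal on $\mathcal{M}^{\rm int}_{\rm sym}(\mathbb{R}^n)$ if and only if $\delta_J \ast R_E P_E(\nu) \neq 0$ for all $J \subset E \subset [n]$ with $|J|$ even. (iii) If $\nu$ is of order $[n]$, then $\nu$ is universal on $\mathcal{M}^{\rm int}_{\rm sym}(\mathbb{R}^n)$ if and only if $\delta_{J,J} \ast \nu \neq 0$ for all $J \subset [n]$ with $|J|$ even. In this case (i.e. when $\nu$ is of order $[n]$ and universal on this space), if $P_E(\nu)$ is even under $T_G$ for some $E \subset [n]$ and $G \subset E$, then $G = \emptyset$ or $G = E$.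
   Context: Let $n \ge 1$ and $[n]=\{1,\dots,n\}$. Measures. A ''measure'' on a Borel set $A \subset \mathbb{R}^n$ is a finite signed measure ($\sigma$-additive, real-valued, on the Borel sets of $A$). $\mathcal{M}(A)$ is the vector space of these, identified with the measures on $\mathbb{R}^n$ concentrated on $A$. $\mu$ is integrable if $\int \|x\|_2\,|\mu|(dx) < \infty$; $\mathcal{M}^{\rm int}(A)$ is the subspace of integrable members of $\mathcal{M}(A)$. Multiplicative convolution. For $\mu,\nu \in \mathcal{M}(\mathbb{R}^n)$, $(\mu\ast\nu)(A) = \int \mu(dx)\int\nu(dy)\,\mathbf{1}_A(xy)$, where $xy$ is the componentwise product. Universality. For $\mathscr{A} \subset \mathcal{M}(\mathbb{R}^n)$, $\nu \in \mathcal{M}(\mathbb{R}^n)$ is universal on $\mathscr{A}$ if for every $\mu \in \mathscr{A}$, $\nu\ast\mu = 0$ implies $\mu = 0$. Decomposition and projection. For $E\subset[n]$, $A_E=\{x\in\mathbb{R}^n:\ \forall i\in[n],\ x_i\ne0\Leftrightarrow i\in E\}$ and $R_E(\mu)=\mu_E$ is the measure $\mu_E(A)=\mu(A\cap A_E)$. $\mu$ is of order $E$ if $|\mu|(A_E)>0$ and $|\mu|(A_F)=0$ for all $F\subset[n]$, $F\ne E$. $P_E:\mathbb{R}^n\to\mathbb{R}^n$ keeps the coordinates $x_j$, $j\in E$, and sets the others to $0$; $P_E(\mu)=\mu\circ P_E^{-1}$. Reflections. For $E \subset [n]$, $T_E:\mathbb{R}^n\to\mathbb{R}^n$ changes the sign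 of the coordinates $x_j$, $j \in E$, and leaves the others unchanged; $T_E(\mu)$ is the image measure. $\mu$ is even under $T_E$ if $T_E(\mu)=\mu$. $\mu$ is symmetric if it is even under $T_{[n]}$, i.e. $\mu(-A)=\mu(A)$ for all Borel $A$; $\mathcal{M}^{\rm int}_{\rm sym}(A)$ is the set of symmetric members of $\mathcal{M}^{\rm int}(A)$, for $A=\mathbb{R}^n$ or $A=A_{[n]}$. Atomic measures. For $E\subset[n]$, $\mathcal{S}^E$ is the set of $s\in\{-1,0,1\}^n$ with $s_j\in\{-1,1\}$ for $j\in E$ and $s_j=0$ for $j\notin E$. For $J\subset E\subset[n]$ with $E\ne\emptyset$, $\delta_{E,J}=2^{-|E|}\sum_{s\in\mathcal{S}^E}\big(\prod_{j\in J}s_j\big)\delta_s$ (empty product $=1$), $\delta_{\emptyset,\emptyset}=\delta_0$ is the Dirac measure at the origin, and for $J\subset[n]$ the symbol $\delta_J$ means $\delta_{[n],J}$. *)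

(* Defs.v *)
From HB Require Import structures.
From mathcomp Require Import all_boot all_order all_algebra.
From mathcomp Require Import all_classical all_reals all_analysis.
From mathcomp Require Import measurable_realfun.

Set Implicit Arguments.
Unset Strict Implicit.
Unset Printing Implicit Defensive.

Import Order.TTheory GRing.Theory Num.Theory.
Import numFieldNormedType.Exports.

Local Open Scope classical_set_scope.
Local Open Scope ring_scope.
Local Open Scope ereal_scope.

(* R^n is [n.-tuple R]: its measurable sets, generated by the coordinate
   functions, are the Borel sets of R^n.  The coordinates are indexed by
   ['I_n].  Finite signed measures are the charges of the library; since a
   charge is a function on all sets, including the non-measurable ones, signed
   measures are compared on measurable sets only. *)

Section signed_measures.
Context d (T : measurableType d) (R : realType).
Implicit Types nu mu : {charge set T -> \bar R}.

(* Hahn decompositions are unique up to null sets, so that [total_variation]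
   and [cintegral] do not depend on the one which is chosen here. *)
Definition hahn_pos nu : set T := projT1 (cid (Hahn_decomposition nu)).

Definition hahn_neg nu : set T :=
  projT1 (cid (projT2 (cid (Hahn_decomposition nu)))).

Lemma hahn_pos_neg nu : hahn_decomposition nu (hahn_pos nu) (hahn_neg nu).
Proof. exact: projT2 (cid (projT2 (cid (Hahn_decomposition nu)))). Qed.

Definition total_variation nu : {measure set T -> \bar R} :=
  charge_variation (hahn_pos_neg nu).

Definition cintegral nu (f : T -> \bar R) : \bar R :=
  \int[jordan_pos (hahn_pos_neg nu)]_x f x -
  \int[jordan_neg (hahn_pos_neg nu)]_x f x.

Definition is_null (m : set T -> \bar R) := forall A, measurable A -> m A = 0.

Definition concentrated_on nu (A : set T) := total_variation nu (~` A) = 0.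

Lemma sum_of_charges (I : Type) (r : seq I)
    (F : I -> {charge set T -> \bar R}) :
  exists c : {charge set T -> \bar R},
    (c : set T -> \bar R) = (fun A => \sum_(i <- r) F i A).
Proof.
elim: r => [|i r [c cE]].
  by exists (czero : {charge set T -> \bar R}); apply/funext => A; rewrite big_nil.
exists (cadd (F i) c : {charge set T -> \bar R}).
by apply/funext => A; rewrite big_cons /= /cadd /= cE.
Qed.

End signed_measures.

(* [pushforward nu f], with the charge structure it gets from the library *)
Definition image_charge d1 d2 (T1 : measurableType d1) (T2 : measurableType d2)
    (R : realType) (f : T1 -> T2) (mf : measurable_fun setT f)
    (nu : {charge set T1 -> \bar R}) : {charge set T2 -> \bar R} :=
  measure_function_pushforward__canonical__charge_Charge nu mf.

Section euclidean.
Context (R : realType) (n : nat).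
Local Notation Rn := (n.-tuple R).
Local Notation charges := ({charge set Rn -> \bar R}).
Implicit Types (E F J G : {set 'I_n}) (nu mu : charges).

Definition norm2 (x : Rn) : R := Num.sqrt (\sum_(i < n) tnth x i ^+ 2)%R.

Definition cmul (x y : Rn) : Rn := [tuple (tnth x i * tnth y i)%R | i < n].

Definition mconv mu nu (A : set Rn) : \bar R :=
  cintegral mu (fun x => cintegral nu (fun y => (\1_A (cmul x y))%:E)).

Definition int_charges (A : set Rn) : set charges :=
  [set mu | concentrated_on mu A /\
            \int[total_variation mu]_x (norm2 x)%:E < +oo].

Definition universal_on (AA : set charges) nu :=
  forall mu, AA mu -> is_null (mconv nu mu) -> is_null mu.

Definition stratum E : set Rn := [set x | forall i, tnth x i != 0%R <-> i \in E].

Lemma measurable_stratum E : measurable (stratum E).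
Proof.
pose c i : set Rn :=
  if i \in E then [set x | tnth x i != 0%R] else [set x | tnth x i = 0%R].
have m0 i : measurable [set x : Rn | tnth x i = 0%R].
  rewrite (_ : mkset _ = (fun x : Rn => tnth x i) @^-1` [set 0%R])//.
  rewrite -[X in measurable X]setTI.
  exact: (@measurable_tnth _ _ n i measurableT _ (measurable_set1 0%R)).
rewrite (_ : stratum E = \bigcap_(i in [set: 'I_n]) c i).
  apply: fin_bigcap_measurable => // i _; rewrite /c; case: ifP => // _.
  rewrite (_ : mkset _ = ~` [set x : Rn | tnth x i = 0%R]).
    exact: measurableC.
  by apply/seteqP; split=> x /= /eqP.
apply/seteqP; split=> x.
  move=> xE i _; rewrite /c; case: ifPn => iE /=; first exact/xE.
  by apply/eqP; apply: contraNT iE => /xE.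
move=> xc i; have := xc i Logic.I; rewrite /c; case: ifPn => iE /=.
  by split.
by move=> ->; rewrite eqxx.
Qed.

Definition restr_charge E nu : charges :=
  crestr nu (measurable_stratum E).

Definition of_order E nu :=
  0 < total_variation nu (stratum E) /\
  forall F, F != E -> total_variation nu (stratum F) = 0.

Definition projf E (x : Rn) : Rn :=
  [tuple if i \in E then tnth x i else 0%R | i < n].

Lemma measurable_projf E : measurable_fun setT (projf E).
Proof.
apply/measurable_fun_tnthP => i; rewrite /projf.
rewrite (_ : _ \o _ = fun x : Rn => if i \in E then tnth x i else 0%R).
  by case: (i \in E) => //; exact: measurable_tnth.
by apply/funext => x /=; rewrite tnth_mktuple.
Qed.

Definition proj_charge E : charges -> charges :=
  image_charge (measurable_projf E).

Definition reflf E (x : Rn) : Rn :=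
  [tuple if i \in E then (- tnth x i)%R else tnth x i | i < n].

Lemma measurable_reflf E : measurable_fun setT (reflf E).
Proof.
apply/measurable_fun_tnthP => i; rewrite /reflf.
rewrite (_ : _ \o _ =
    fun x : Rn => if i \in E then (- tnth x i)%R else tnth x i).
  case: (i \in E); last exact: measurable_tnth.
  exact: measurable_funN (@measurable_tnth _ _ n i).
by apply/funext => x /=; rewrite tnth_mktuple.
Qed.

Definition refl_charge E : charges -> charges :=
  image_charge (measurable_reflf E).

Definition even_under E mu :=
  forall A, measurable A -> refl_charge E mu A = mu A.

Definition symmetric_charge mu := even_under [set: 'I_n]%SET mu.

Definition int_sym_charges (A : set Rn) : set charges :=
  int_charges A `&` [set mu | symmetric_charge mu].

Definition sign_vectors E : set Rn :=
  [set s | forall j, if j \in E then tnth s j = (-1)%R \/ tnth s j = 1%R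
                     else tnth s j = 0%R].

Lemma finite_sign_vectors E : finite_set (sign_vectors E).
Proof.
pose f (g : {ffun 'I_n -> 'I_3}) : Rn := [tuple ((g i)%:R - 1)%R | i < n].
apply: (@sub_finite_set _ _ (f @` setT)); last exact: finite_image.
move=> s sE.
pose h j := if tnth s j == (-1)%R then (inord 0 : 'I_3)
            else if tnth s j == 0%R then inord 1 else inord 2.
exists [ffun j => h j] => //; apply: eq_from_tnth => j.
rewrite tnth_mktuple ffunE /h; have := sE j.
case: eqP => [-> _|sN1]; first by rewrite inordK// sub0r.
case: eqP => [-> _|s0]; first by rewrite inordK// subrr.
rewrite inordK//; case: ifP => _ // -[//|->].
by rewrite -[2%:R]/(1 + 1)%R addrK.
Qed.

(* For E empty the only sign vector is the origin and both scalars are 1, so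
   that [delta finset.set0 finset.set0] is the Dirac measure at the origin. *)
Definition delta E J (A : set Rn) : \bar R :=
  ((2 ^- #|E|)%R)%:E *
  \sum_(s \in sign_vectors E) (\prod_(j in J) tnth s j)%R%:E * \d_s A.

Lemma delta_charge E J : exists c : charges,
  (c : set Rn -> \bar R) = delta E J.
Proof.
have [c cE] := sum_of_charges (finmap.enum_fset (fset_set (sign_vectors E)))
    (fun s =>
  cscale (\prod_(j in J) tnth s j)%R (charge_of_finite_measure \d_s)).
exists (cscale (2 ^- #|E|)%R c); apply/funext => A.
rewrite /delta (fsbig_finite _ _ (finite_sign_vectors E)).
congr (_ * _); refine (etrans (congr1 (fun m => m A) cE) _).
by refine (eq_bigr _ _).
Qed.

Let delta0 E J : delta E J set0 = 0.
Proof. by have [c <-] := delta_charge E J; exact: charge0. Qed.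

Let delta_fin E J A : measurable A -> delta E J A \is a fin_num.
Proof. by have [c <-] := delta_charge E J; exact: fin_num_measure. Qed.

Let delta_sigma_additive E J : semi_sigma_additive (delta E J).
Proof.
by have [c <-] := delta_charge E J; exact: charge_semi_sigma_additive.
Qed.

HB.instance Definition _ E J := isCharge.Build _ _ _ (delta E J)
  (delta0 E J) (@delta_fin E J) (@delta_sigma_additive E J).

Definition origin : Rn := [tuple 0%R | i < n].

Lemma delta_set0 A : delta finset.set0 finset.set0 A = \d_origin A.
Proof.
rewrite /delta cards0 expr0 invr1 mul1e.
rewrite (_ : sign_vectors finset.set0 = [set origin]).
  by rewrite fsbig_set1 big_set0 mul1e.
apply/seteqP; split=> [s sE|_ -> j]; last by rewrite inE tnth_mktuple.
by apply: eq_from_tnth => j; have := sE j; rewrite inE tnth_mktuple.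
Qed.

End euclidean.

(* Main.v *)
From HB Require Import structures.
Require Import Defs.
From mathcomp Require Import all_boot all_order all_algebra.
From mathcomp Require Import all_classical all_reals all_analysis.
From mathcomp Require Import measurable_realfun.
From mathcomp Require Import ring lra.

Import Order.TTheory GRing.Theory Num.Theory.
Import numFieldNormedType.Exports.

Set Implicit Arguments.
Unset Strict Implicit.
Unset Printing Implicit Defensive.

Local Open Scope classical_set_scope.
Local Open Scope ring_scope.

(** The map x |-> (log|x_i|)_i, together with the signs of the x_i, turns
multiplicative convolution on the open stratum into additive convolution on
R^n times the group of signs.  Averaging against the characters
prod_(j in J) sgn x_j of the sign group splits a signed measure nu into
components indexed by J; for every E, the same applies to the part of the
projection P_E(nu) where the coordinates in E are nonzero.  All conditions of
the theorem are of the form 'the component of index (E, J) of nu is not zero'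
([component_null], [null_restr_proj], [null_restr], [null_delta_self]).

The analytic heart is that a convolution of two components can vanish only if
one of the factors does ([component_dichotomy]); this is where integrability
is needed, since finite signed measures do have zero divisors for convolution.
Put chi(x) = prod_(j in J) sgn x_j when the coordinates in E are nonzero and
chi(x) = 0 otherwise, let a > 0 be small, and for a direction t put
l_t(x) = sum_(i in E) t_i log|x_i|.  The factor exp(a l_1) makes all moments
p_k(t) = int chi exp(a l_1) l_t^k dnu finite, because near the axes it beats
every power of the logarithms, and at infinity it is dominated by 1 + |x|.
As chi is multiplicative and l_t additive, if nu * mu = 0 the binomial formula
gives sum_j 'C(k, j) p_(k-j)(t) q_j(t) = 0, q_j being the moments of mu.
Taking the least orders at which moments of nu and of mu do not vanish
identically in t, one gets two nonzero polynomials in t whose product is zero,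
which is absurd: all moments of nu, or all moments of mu, vanish
([moment_dichotomy]).

The moments determine the component ([moments_determine]).  The multipliers g
preserving the class of bounded functions h such that all moments of h nu
vanish form an algebra closed under bounded pointwise limits.  By exponential
integrability the power series of sine and cosine can be integrated term by
term, so that sin(d (log|x_i| - b)) is a multiplier for small d.  Iterating the
polynomial (3 s - s^3) / 2, which converges to sgn s on [-1, 1], and letting d
tend to 0, one gets sgn(log|x_i| - b), hence the indicator function of every
Borel set in the variables log|x_i|.  Letting finally a tend to 0 removes the
weight.

The rest is finite Fourier analysis on the sign group.  If nu is such that no
component of even index vanishes and nu * mu = 0 with mu symmetric, then the
even components of mu vanish by the dichotomy and the odd ones by symmetry;
Fourier inversion ([character_sum]) gives R_E P_E(mu) = 0 for all E, and a
downward induction on E gives mu = 0 ([strata_null]).  Conversely, if the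
component (E, J) of nu vanishes with |J| even, then the convolution of
delta_(E, J) with the product over i in E of delta_1 - delta_2 (and delta_0 in
the other coordinates) is a symmetric measure that nu annihilates
([not_universal]).  Finally, when nu is carried by the open stratum, its
(E, J) component determines its (J, J) component, so that E = J suffices, and
if P_E(nu) is even under T_G with i in G and j in E outside G, then the
component of index {i, j} is both preserved and reversed by T_G, hence zero
([even_under_component_null]). *)

(** * Integrable real functions *)

Section integration.
Context d (T : measurableType d) (R : realType).
Variable mu : {measure set T -> \bar R}.
Implicit Types f g h : T -> R.

Definition intg f := mu.-integrable setT (EFin \o f).

Lemma intg_measurable f : intg f -> measurable_fun setT f.
Proof. by move=> /integrableP[/measurable_EFinP]. Qed.

Lemma intg_le f g (C : R) : measurable_fun setT f -> intg g ->
  (forall x, `|f x| <= C * g x) -> intg f.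
Proof.
move=> mf ig fg.
have iCg : intg (fun x => C * g x).
  exact: eq_integrable (integrableZl measurableT C ig).
apply: (le_integrable measurableT _ _ iCg); first exact/measurable_EFinP.
move=> x _ /=; rewrite lee_fin; apply: le_trans (fg x) _; exact: ler_norm.
Qed.

Lemma intgD f g : intg f -> intg g -> intg (fun x => f x + g x).
Proof. by move=> If Ig; exact: eq_integrable (integrableD _ If Ig). Qed.

Lemma intgZ c f : intg f -> intg (fun x => c * f x).
Proof. by move=> If; exact: eq_integrable (integrableZl _ c If). Qed.

Lemma intg_sum I (r : seq I) (F : I -> T -> R) :
  (forall i, intg (F i)) -> intg (fun x => \sum_(i <- r) F i x).
Proof.
move=> iF; elim: r => [|i r ih].
  by apply: eq_integrable (integrable0 mu setT) => // x _ /=; rewrite big_nil.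
by apply: eq_integrable (intgD (iF i) ih) => // x _ /=; rewrite big_cons.
Qed.

Lemma Rintegral_sum I (r : seq I) (F : I -> T -> R) :
  (forall i, intg (F i)) ->
  \int[mu]_x (\sum_(i <- r) F i x) = \sum_(i <- r) \int[mu]_x F i x.
Proof.
move=> iF; elim: r => [|i r ih].
  rewrite big_nil; under eq_Rintegral do rewrite big_nil.
  by rewrite /Rintegral integral0.
rewrite big_cons -ih; under eq_Rintegral do rewrite big_cons.
by apply: RintegralD => //; [exact: iF | exact: intg_sum].
Qed.

Lemma Rintegral_dominated (f_ : nat -> T -> R) f g :
  (forall m, measurable_fun setT (f_ m)) -> intg g ->
  (forall m x, `|f_ m x| <= g x) ->
  (forall x, f_ m x @[m --> \oo] --> f x) ->
  intg f /\ \int[mu]_x f_ m x @[m --> \oo] --> \int[mu]_x f x.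
Proof.
move=> mf ig fg ff.
have mf' : measurable_fun setT f.
  by apply: (measurable_fun_cvg mf) => x _; exact: ff.
have mf1 m : measurable_fun setT (EFin \o f_ m) by exact/measurable_EFinP.
have mf2 : measurable_fun setT (EFin \o f) by exact/measurable_EFinP.
have ff1 : \forall x \ae mu, setT x -> (EFin \o f_ m) x @[m --> \oo] --> (EFin \o f) x.
  by apply: aeW => x _; apply: cvg_EFin; [exact: nearW | exact: ff].
have fg1 : \forall x \ae mu, forall m, setT x ->
    (`|(EFin \o f_ m) x| <= (EFin \o g) x)%E.
  by apply: aeW => x m _ /=; rewrite lee_fin.
have [] := dominated_convergence measurableT mf1 mf2 ff1 ig fg1.
move=> If _ cvgf; split => //.
by apply: fine_cvg; rewrite fineK//; exact: integrable_fin_num.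
Qed.

Lemma Rintegral_eq0_lim (f_ : nat -> T -> R) f g :
  (forall m, measurable_fun setT (f_ m)) -> intg g ->
  (forall m x, `|f_ m x| <= g x) ->
  (forall x, f_ m x @[m --> \oo] --> f x) ->
  (forall m, \int[mu]_x f_ m x = 0) -> \int[mu]_x f x = 0.
Proof.
move=> mf ig fg ff f0; have [_ h] := Rintegral_dominated mf ig fg ff.
apply: cvg_unique h _ => //; rewrite (_ : (fun m => _) = cst 0) ; first exact: cvg_cst.
by apply/funext => m; exact: f0.
Qed.

End integration.

Import HBNNSimple.

(** * Bounded measurable functions *)

Section bounded_functions.
Context d (T : measurableType d) (R : realType).
Implicit Types f g h : T -> R.

Definition bmeas f :=
  measurable_fun setT f /\ exists M : R, forall x, `|f x| <= M.

Lemma bmeas_indic A : measurable A -> bmeas \1_A.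
Proof.
move=> mA; split=> //; exists 1 => x.
by rewrite indicE; case: (_ \in _); rewrite ?normr1 ?normr0.
Qed.

Lemma bmeas_cst c : bmeas (cst c).
Proof. by split => //; exists `|c|. Qed.

Lemma bmeasD f g : bmeas f -> bmeas g -> bmeas (fun x => f x + g x).
Proof.
move=> [mf [M fM]] [mg [N gN]]; split; first exact: measurable_funD.
by exists (M + N) => x; rewrite (le_trans (ler_normD _ _))// lerD.
Qed.

Lemma bmeasM f g : bmeas f -> bmeas g -> bmeas (fun x => f x * g x).
Proof.
move=> [mf [M fM]] [mg [N gN]]; split; first exact: measurable_funM.
by exists (M * N) => x; rewrite normrM ler_pM.
Qed.

Lemma bmeasZ c f : bmeas f -> bmeas (fun x => c * f x).
Proof. exact/bmeasM/bmeas_cst. Qed.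

Lemma bmeas_sum I (r : seq I) (F : I -> T -> R) :
  (forall i, bmeas (F i)) -> bmeas (fun x => \sum_(i <- r) F i x).
Proof.
move=> bF; elim: r => [|i r ih].
  by under eq_fun do rewrite big_nil; exact: bmeas_cst.
by under eq_fun do rewrite big_cons; exact: bmeasD.
Qed.

(** Functional form of the monotone class theorem: simple functions are dense
in the bounded measurable functions for bounded pointwise convergence. *)
Lemma bounded_measurable_ind (P : set (T -> R)) :
  (forall A, measurable A -> P \1_A) ->
  (forall f g, bmeas f -> bmeas g -> P f -> P g -> P (fun x => f x + g x)) ->
  (forall c f, bmeas f -> P f -> P (fun x => c * f x)) ->
  (forall (f_ : nat -> T -> R) (M : R) f, (forall m, bmeas (f_ m)) -> (forall m, P (f_ m)) ->
    (forall m x, `|f_ m x| <= M) ->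
    (forall x, f_ m x @[m --> \oo] --> f x) -> P f) ->
  forall f, bmeas f -> P f.
Proof.
move=> P1 PD PZ Plim.
have Pge0 f : bmeas f -> (forall x, 0 <= f x) -> P f.
  move=> [mf [M fM]] f0.
  have mEf : measurable_fun setT (EFin \o f) by exact/measurable_EFinP.
  have f0' x : setT x -> (0 <= (EFin \o f) x)%E by rewrite lee_fin.
  pose f_ m := approx setT (EFin \o f) m.
  have f_E m : f_ m = nnsfun_approx measurableT mEf m by rewrite nnsfun_approxE.
  have f_ge0 m x : 0 <= f_ m x by rewrite f_E; exact: fun_ge0.
  have f_le m x : f_ m x <= f x by rewrite -lee_fin; exact: (le_approx m f0').
  have f_M m x : `|f_ m x| <= M.
    rewrite ger0_norm// (le_trans (f_le m x))//.
    by rewrite (le_trans _ (fM x))// ler_norm.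
  have f_b m : bmeas (f_ m).
    by split; [rewrite f_E; exact: measurable_funPT | exists M].
  apply: (Plim f_ M) => // [m|x]; last exact: (@cvg_approx _ _ _ setT (EFin \o f) x f0' Logic.I (ltry _)).
  rewrite f_E.
  rewrite (_ : HBNNSimple.NonNegSimpleFun.sort _ =
     (fun x => \sum_(y \in range (nnsfun_approx measurableT mEf m))
        y * \1_((nnsfun_approx measurableT mEf m) @^-1` [set y]) x)); last first.
    by apply/funext => x; rewrite -fimfunE.
  set s := nnsfun_approx _ _ _.
  under eq_fun do rewrite fsbig_finite//.
  suff H (r : seq R) : bmeas (fun x => \sum_(y <- r) y * \1_(s @^-1` [set y]) x)
     /\ P (fun x => \sum_(y <- r) y * \1_(s @^-1` [set y]) x).
    by have [] := H (finmap.enum_fset (fset_set (range s))).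
  have ms y : measurable (s @^-1` [set y]) by exact: measurable_funPTI.
  elim: r => [|y r [ih1 ih2]].
    under eq_fun do rewrite big_nil.
    split; first exact: bmeas_cst.
    have := P1 set0 measurable0; rewrite indic0.
    by rewrite (_ : cst 0 = fun=> 0).
  under eq_fun do rewrite big_cons.
  have b1 := bmeasZ y (bmeas_indic (ms y)).
  split; first exact: bmeasD.
  by apply: PD => //; apply: PZ; [exact: bmeas_indic | exact: P1].
move=> f [mf [M fM]].
have bM : bmeas (fun x => f x + M).
  by apply: bmeasD; [split => //; exists M | exact: bmeas_cst].
have PM : P (fun x => f x + M).
  by apply: Pge0 => // x; rewrite -lerBlDr sub0r; have /ler_normlP[] := fM x; lra.
rewrite (_ : f = fun x => (f x + M) + (- M) * \1_setT x); last first.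
  by apply/funext => x; rewrite indicT /=; lra.
apply: PD => //; first by apply: bmeasZ; exact: bmeas_indic.
by apply: PZ; [exact: bmeas_indic | exact: P1].
Qed.

Lemma bmeas_lim (f_ : nat -> T -> R) (M : R) f : (forall m, bmeas (f_ m)) ->
  (forall m x, `|f_ m x| <= M) -> (forall x, f_ m x @[m --> \oo] --> f x) ->
  bmeas f.
Proof.
move=> bf fM ff; split.
  apply: (@measurable_fun_cvg _ _ _ _ f_) => [m|x _]; last exact: ff.
  by have [] := bf m.
exists M => x; have fx : `|f_ m x| @[m --> \oo] --> `|f x| by apply: cvg_norm; exact: ff.
by apply: (cvgr_to_le fx); exact: nearW.
Qed.

(** Linear functionals with the continuity given by dominated convergence; two
of them that agree on indicator functions are equal ([bfunctional_ext]), which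
is how identities between signed measures are turned into identities between
integrals. *)
Definition bfunctional (L : (T -> R) -> R) :=
  [/\ forall f g, bmeas f -> bmeas g -> L (fun x => f x + g x) = L f + L g,
      forall c f, bmeas f -> L (fun x => c * f x) = c * L f &
      forall (f_ : nat -> T -> R) (M : R) f, (forall m, bmeas (f_ m)) -> (forall m x, `|f_ m x| <= M) ->
        (forall x, f_ m x @[m --> \oo] --> f x) -> L (f_ m) @[m --> \oo] --> L f].

Lemma bfunctional_ext L1 L2 : bfunctional L1 -> bfunctional L2 ->
  (forall A, measurable A -> L1 \1_A = L2 \1_A) ->
  forall f, bmeas f -> L1 f = L2 f.
Proof.
move=> [D1 Z1 C1] [D2 Z2 C2] L12; apply: bounded_measurable_ind => //.
- by move=> f g bf bg fE gE; rewrite D1// D2// fE gE.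
- by move=> c f bf fE; rewrite Z1// Z2// fE.
- move=> f_ M f bf fE fM ff.
  have h1 := C1 _ _ _ bf fM ff; have h2 := C2 _ _ _ bf fM ff.
  apply: cvg_unique h1 _ => //.
  by rewrite (_ : (fun m => L1 (f_ m)) = (fun m => L2 (f_ m)))//; exact/funext.
Qed.

Lemma bfunctional_sum I (r : seq I) (L : I -> (T -> R) -> R) :
  (forall i, bfunctional (L i)) ->
  bfunctional (fun f => \sum_(i <- r) L i f).
Proof.
move=> bL; split.
- move=> f g bf bg; rewrite -big_split/=; apply: eq_bigr => i _.
  by have [-> //] := bL i.
- move=> c f bf; rewrite big_distrr/=; apply: eq_bigr => i _.
  by have [_ -> //] := bL i.
- move=> f_ M f bf fM ff; apply: cvg_big => [|i _]; first exact: add_continuous.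
  by have [_ _ C] := bL i; exact: C bf fM ff.
Qed.

Lemma bfunctional_scale c L :
  bfunctional L -> bfunctional (fun f => c * L f).
Proof.
move=> [D Z C]; split.
- by move=> f g bf bg; rewrite D// mulrDr.
- by move=> a f bf; rewrite Z// mulrCA.
- by move=> f_ M f bf fM ff; apply: cvgMr => //; exact: C bf fM ff.
Qed.

Lemma bfunctional0 : bfunctional (fun=> 0).
Proof. by split => *; rewrite ?addr0 ?mulr0//; exact: cvg_cst. Qed.

Lemma bfunctional_eval x : bfunctional (fun f => f x).
Proof. by split. Qed.

End bounded_functions.

Lemma bmeas_comp d1 d2 (X : measurableType d1) (Y : measurableType d2)
  (R : realType) (phi : X -> Y) (f : Y -> R) :
  measurable_fun setT phi -> bmeas f -> bmeas (fun x => f (phi x)).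
Proof.
move=> mphi [mf [M fM]]; split; first exact: measurableT_comp.
by exists M.
Qed.

Section image_functional.
Context d1 d2 (X : measurableType d1) (Y : measurableType d2) (R : realType).
Variables (mu : {measure set X -> \bar R}) (g : X -> R) (phi : X -> Y).
Hypotheses (ig : intg mu g) (mphi : measurable_fun setT phi).

Lemma intgM_bounded (f : X -> R) : bmeas f -> intg mu (fun x => g x * f x).
Proof.
move=> [mf [M fM]].
apply: (@intg_le _ _ _ _ _ (fun x => `|g x|) M).
- by apply: measurable_funM => //; exact: intg_measurable ig.
- exact: integrable_norm.
- by move=> x; rewrite normrM mulrC ler_wpM2r.
Qed.

Lemma bfunctional_Rintegral :
  bfunctional (fun f : Y -> R => \int[mu]_x (g x * f (phi x))).
Proof.
have I f : bmeas f -> intg mu (fun x => g x * f (phi x)).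
  by move=> bf; apply: intgM_bounded; exact: bmeas_comp.
split.
- move=> f h bf bh; rewrite -RintegralD//; try exact: I.
  by apply: eq_Rintegral => x _; rewrite mulrDr.
- move=> c f bf; rewrite -RintegralZl//; last exact: I.
  by apply: eq_Rintegral => x _; rewrite mulrCA.
- move=> f_ M f bf fM ff.
  have ifg : intg mu (fun x => M * `|g x|) by apply: intgZ; exact: integrable_norm.
  apply: (Rintegral_dominated _ ifg _ _).2.
  + move=> m; exact: intg_measurable (I _ (bf m)).
  + by move=> m x; rewrite normrM mulrC ler_wpM2r.
  + by move=> x; apply: cvgMr; exact: ff.
Qed.

(** The hypothesis says that the image under phi of the signed measure of
density g is zero; an integrable F need not be bounded, so it is truncated to
the sets |F| <= m before passing to the limit. *)
Lemma Rintegral_image_eq0 (F : Y -> R) :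
  (forall B, measurable B -> \int[mu]_x (g x * \1_B (phi x)) = 0) ->
  measurable_fun setT F -> intg mu (fun x => g x * F (phi x)) ->
  \int[mu]_x (g x * F (phi x)) = 0.
Proof.
move=> g0 mF iF.
have L0 := @bfunctional0 _ Y R.
pose B m : set Y := [set y | `|F y| <= m%:R].
have mB m : measurable (B m).
  rewrite -[B m]setTI.
  rewrite (_ : B m = (Num.norm \o F) @^-1` [set` `]-oo, m%:R]]).
    by apply: measurableT_comp.
  by apply/seteqP; split=> y; rewrite /B /= in_itv.
pose F_ m y := F y * \1_(B m) y.
have bF m : bmeas (F_ m).
  split; first by apply: measurable_funM => //; exact: measurable_indic.
  exists m%:R => y; rewrite /F_ indicE; have [yB|yB] := boolP (y \in B m).
    by rewrite mulr1; move: yB; rewrite inE.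
  by rewrite mulr0 normr0.
apply: (@Rintegral_eq0_lim _ _ _ _ (fun m x => g x * F_ m (phi x)) _
   (fun x => `|g x * F (phi x)|)).
- by move=> m; apply: intg_measurable (intgM_bounded (bmeas_comp mphi (bF m))).
- exact: integrable_norm.
- move=> m x; rewrite /F_ indicE !normrM; case: (_ \in _); rewrite ?normr1 ?mulr1//.
  by rewrite normr0 !mulr0 mulr_ge0.
- move=> x; apply: cvgMr; apply: cvg_near_cst; near=> m.
  rewrite /F_ indicE mem_set ?mulr1// /B /=.
  by apply: ltW; near: m; exact: nbhs_infty_gtr.
- move=> m; exact: (bfunctional_ext bfunctional_Rintegral L0 g0 (bF m)).
Unshelve. all: by end_near. Qed.

End image_functional.

(** * Integration against a signed measure *)

Section charge_variation_finite.
Context d (T : measurableType d) (R : realType).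
Variables (nu : {charge set T -> \bar R}) (P N : set T).
Variable nuPN : hahn_decomposition nu P N.

Let charge_variation_fin : fin_num_fun (charge_variation nuPN).
Proof. by move=> A mA; rewrite fin_numD !fin_num_measure. Qed.

HB.instance Definition _ := @Measure_isFinite.Build _ _ _
  (charge_variation nuPN) charge_variation_fin.

End charge_variation_finite.

Section signed_integral.
Context d (T : measurableType d) (R : realType).
Implicit Types (nu : {charge set T -> \bar R}) (f g h : T -> R).

Definition tv nu : {finite_measure set T -> \bar R} :=
  charge_variation (hahn_pos_neg nu).

Definition hsign nu (x : T) : R := \1_(hahn_pos nu) x - \1_(hahn_neg nu) x.

(** Integral against nu, written with the density of nu with respect to its
total variation, so that the theory of integration for positive measures
applies. *)
Definition sint nu f : R := \int[tv nu]_x (hsign nu x * f x).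

Lemma measurable_hahn_pos nu : measurable (hahn_pos nu).
Proof. by have [[]] := hahn_pos_neg nu. Qed.

Lemma measurable_hahn_neg nu : measurable (hahn_neg nu).
Proof. by have [_ []] := hahn_pos_neg nu. Qed.

Lemma bmeas_hsign nu : bmeas (hsign nu).
Proof.
rewrite /hsign; under eq_fun do rewrite -mulN1r.
apply: bmeasD; first exact/bmeas_indic/measurable_hahn_pos.
exact/bmeasZ/bmeas_indic/measurable_hahn_neg.
Qed.

Lemma normr_hsign nu x : `|hsign nu x| = 1.
Proof.
have [_ _ PN PN0] := hahn_pos_neg nu.
have : (hahn_pos nu `|` hahn_neg nu) x by rewrite PN.
have PN0x : ~ (hahn_pos nu `&` hahn_neg nu) x by rewrite PN0.
rewrite /hsign !indicE; case=> [xP|xN].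
  by rewrite mem_set// memNset ?subr0 ?normr1// => xN; apply: PN0x.
by rewrite memNset ?mem_set ?sub0r ?normrN1// => xP; apply: PN0x.
Qed.

Lemma intg_finite (mu : {finite_measure set T -> \bar R}) f :
  bmeas f -> intg mu f.
Proof.
move=> [mf [M fM]].
apply: (@intg_le _ _ _ _ _ (cst 1) M) => //.
  exact: finite_measure_integrable_cst.
by move=> x; rewrite mulr1.
Qed.

Lemma bfunctional_sint d' (Y : measurableType d') nu h (phi : T -> Y) :
  bmeas h -> measurable_fun setT phi ->
  bfunctional (fun F : Y -> R => sint nu (fun x => h x * F (phi x))).
Proof.
move=> bh mphi; rewrite /sint.
under eq_fun do under eq_Rintegral do rewrite mulrA.
by apply: bfunctional_Rintegral => //; apply/intg_finite/bmeasM => //; exact: bmeas_hsign.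
Qed.

Lemma bfunctional_sint_id nu : bfunctional (sint nu).
Proof.
have := @bfunctional_sint _ T nu (cst 1) id (bmeas_cst _ 1) (@measurable_id _ _ _).
rewrite (_ : (fun f => _) = sint nu)//; apply/funext => f; congr sint.
by apply/funext => x; rewrite mul1r.
Qed.

Lemma intg_hsign nu f : intg (tv nu) f -> intg (tv nu) (fun x => hsign nu x * f x).
Proof.
move=> If; apply: (@intg_le _ _ _ _ _ (fun x => `|f x|) 1).
- apply: measurable_funM; first by have [] := bmeas_hsign nu.
  exact: intg_measurable If.
- exact: integrable_norm.
- by move=> x; rewrite normrM normr_hsign.
Qed.

Lemma sintD nu f g : intg (tv nu) f -> intg (tv nu) g ->
  sint nu (fun x => f x + g x) = sint nu f + sint nu g.
Proof.
move=> If Ig; rewrite /sint -RintegralD//; try exact: intg_hsign.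
by apply: eq_Rintegral => x _; rewrite mulrDr.
Qed.

Lemma sintZ nu c f : intg (tv nu) f -> sint nu (fun x => c * f x) = c * sint nu f.
Proof.
move=> If; rewrite /sint -RintegralZl//; last exact: intg_hsign.
by apply: eq_Rintegral => x _; rewrite mulrCA.
Qed.

Lemma sint_sum I (r : seq I) nu (F : I -> T -> R) :
  (forall i, intg (tv nu) (F i)) ->
  sint nu (fun x => \sum_(i <- r) F i x) = \sum_(i <- r) sint nu (F i).
Proof.
move=> iF; rewrite /sint -Rintegral_sum; last by move=> i; exact: intg_hsign.
by apply: eq_Rintegral => x _; rewrite big_distrr.
Qed.

Lemma sint_eq0_lim nu (f_ : nat -> T -> R) f g :
  (forall m, measurable_fun setT (f_ m)) -> intg (tv nu) g ->
  (forall m x, `|f_ m x| <= g x) ->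
  (forall x, f_ m x @[m --> \oo] --> f x) ->
  (forall m, sint nu (f_ m) = 0) -> sint nu f = 0.
Proof.
move=> mf ig fg ff; apply: (Rintegral_eq0_lim _ ig).
- by move=> m; apply: measurable_funM => //; have [] := bmeas_hsign nu.
- by move=> m x; rewrite normrM normr_hsign mul1r.
- by move=> x; apply: cvgMr; exact: ff.
Qed.

Lemma sint_indic nu A : measurable A -> ((sint nu \1_A)%:E = nu A)%E.
Proof.
move=> mA; have mP := measurable_hahn_pos nu; have mN := measurable_hahn_neg nu.
have [_ _ PN PN0] := hahn_pos_neg nu.
have E B : measurable B -> \int[tv nu]_x \1_B x = fine (tv nu B).
  by move=> mB; rewrite /Rintegral integral_indic// setIT.
have -> : sint nu \1_A = fine (tv nu (hahn_pos nu `&` A)) -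
    fine (tv nu (hahn_neg nu `&` A)).
  rewrite -!E; try exact: measurableI.
  rewrite -RintegralB//; try by apply/intg_finite/bmeas_indic/measurableI.
  by apply: eq_Rintegral => x _; rewrite /hsign mulrBl !indicI.
rewrite EFinB !fineK; try by rewrite fin_num_measure//; exact: measurableI.
rewrite /tv /= /charge_variation /= !jordan_posE !jordan_negE !cjordan_posE !cjordan_negE.
rewrite /crestr0 !mem_set; try exact: measurableI.
rewrite /crestr.
have E1 (P N : set T) : P `&` N = set0 -> (P `&` A) `&` N = set0.
  by move=> PN'; rewrite setIAC PN' set0I.
have E2 (P : set T) : (P `&` A) `&` P = P `&` A by rewrite setIAC setIid.
have NP0 : hahn_neg nu `&` hahn_pos nu = set0 by rewrite setIC.
rewrite !E2 (E1 _ _ PN0) (E1 _ _ NP0) charge0 oppe0 adde0 add0e oppeK.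
rewrite -chargeU; last by rewrite setIACA PN0 set0I.
- by rewrite -setIUl PN setTI.
- exact: measurableI.
- exact: measurableI.
Qed.

Lemma cintegral_sint nu f : bmeas f ->
  cintegral nu (EFin \o f) = (sint nu f)%:E.
Proof.
move=> bf; pose jp := jordan_pos (hahn_pos_neg nu).
pose jn := jordan_neg (hahn_pos_neg nu).
have b1 (m : {finite_measure set T -> \bar R}) :
    bfunctional (fun f => \int[m]_x f x).
  have := bfunctional_Rintegral (intg_finite m (bmeas_cst _ 1)) (@measurable_id _ T setT).
  rewrite (_ : (fun f => _) = (fun f => \int[m]_x f x))//.
  apply/funext => g; congr fine; congr (integral m); apply/funext => x.
  by rewrite mul1r.
have bL : bfunctional (fun f => \int[jp]_x f x + (-1) * \int[jn]_x f x).
  have := bfunctional_sum [:: true; false] (L := fun b f =>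
    if b then \int[jp]_x f x else (-1) * \int[jn]_x f x).
  under eq_fun do rewrite big_cons big_seq1.
  by apply=> -[]; [exact: b1 | apply: bfunctional_scale; exact: b1].
rewrite -(bfunctional_ext bL (bfunctional_sint_id nu) _ bf); last first.
  move=> A mA; apply: EFin_inj; rewrite sint_indic//.
  rewrite (jordan_decomp (hahn_pos_neg nu))// /cadd /= cscaleN1 EFinD mulN1r EFinN.
  by rewrite /Rintegral !fineK !integral_indic// setIT// fin_num_measure.
rewrite mulN1r EFinB /Rintegral !fineK//;
  by apply: integrable_fin_num => //; exact: intg_finite.
Qed.

Lemma is_nullP nu : is_null nu <-> forall f, bmeas f -> sint nu f = 0.
Proof.
split=> [nu0 f bf|nu0 A mA]; last by rewrite -sint_indic// nu0//; exact: bmeas_indic.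
have L0 := @bfunctional0 _ T R.
rewrite (bfunctional_ext (bfunctional_sint_id nu) L0)// => A mA.
by apply: EFin_inj; rewrite sint_indic// nu0.
Qed.

Lemma sint_eq_off_null nu N f g : measurable N -> tv nu N = 0 ->
  bmeas f -> bmeas g -> (forall x, ~ N x -> f x = g x) -> sint nu f = sint nu g.
Proof.
move=> mN N0 bf bg fg; congr fine; apply: ae_eq_integral => //.
- exact/measurable_EFinP/(intg_measurable (intg_hsign (intg_finite _ bf))).
- exact/measurable_EFinP/(intg_measurable (intg_hsign (intg_finite _ bg))).
exists N; split => // x /= /not_implyP[_ fgx]; apply: contrapT => Nx.
by apply: fgx; rewrite fg.
Qed.

End signed_integral.

Lemma sint_image d1 d2 (X : measurableType d1) (Y : measurableType d2)
    (R : realType) (phi : X -> Y) (mphi : measurable_fun setT phi)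
    (nu : {charge set X -> \bar R}) f : bmeas f ->
  sint (image_charge mphi nu) f = sint nu (fun x => f (phi x)).
Proof.
move=> bf.
have := @bfunctional_sint _ X R _ Y nu (cst 1) phi (bmeas_cst _ 1) mphi.
have -> : (fun f : Y -> R => sint nu (fun x => cst 1 x * f (phi x))) =
    (fun f => sint nu (fun x => f (phi x))).
  by apply/funext => g; congr (sint nu _); apply/funext => x; rewrite mul1r.
move=> bL; apply: (bfunctional_ext (bfunctional_sint_id _) bL) => // A mA.
apply: EFin_inj; rewrite sint_indic//.
rewrite (_ : (fun x => \1_A (phi x)) = \1_(phi @^-1` A)); last first.
  by apply/funext => x; rewrite !indicE; congr (_%:R); apply/idP/idP; rewrite !inE.
rewrite sint_indic//; rewrite -[X in measurable X]setTI; exact: mphi.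
Qed.

Lemma sint_crestr d (T : measurableType d) (R : realType) (D : set T)
    (mD : measurable D) (nu : {charge set T -> \bar R}) f : bmeas f ->
  sint (crestr nu mD) f = sint nu (fun x => \1_D x * f x).
Proof.
move=> bf.
have bL := bfunctional_sint nu (bmeas_indic R mD) (@measurable_id _ T setT).
apply: (bfunctional_ext (bfunctional_sint_id _) bL) => // A mA.
apply: EFin_inj; rewrite sint_indic// /crestr.
rewrite (_ : (fun x => _) = \1_(A `&` D)).
  by rewrite sint_indic//; exact: measurableI.
by apply/funext => x; rewrite indicI mulrC.
Qed.

(** * Characters and logarithmic coordinates *)

Section power_bound.
Variable R : realType.

Lemma exprn_le_expR (c y : R) k : 0 < c -> 0 <= y ->
  y ^+ k <= k`!%:R / c ^+ k * expR (c * y).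
Proof.
move=> c0 y0; have ck : 0 < c ^+ k by rewrite exprn_gt0.
have cy : 0 <= c * y by rewrite mulr_ge0// ltW.
rewrite mulrAC ler_pdivlMr// -exprMn [y * c]mulrC [leRHS]mulrC.
rewrite -ler_pdivrMr ?ltr0n ?fact_gt0//.
case: k ck => [|k] ck.
  by rewrite expr0 fact0 invr1 mul1r (le_trans _ (expR_ge1Dx _))// lerDl.
by apply: le_trans (expR_ge1Dxn k cy); rewrite lerDr.
Qed.

Lemma measurable_fun_sgr : measurable_fun [set: R] (Num.sg : R -> R).
Proof.
rewrite (_ : Num.sg = fun x : R => \1_`]0, +oo[ x - \1_`]-oo, 0[ x).
  by apply: measurable_funB; exact: measurable_indic.
apply/funext => x; rewrite !indicE !mem_setE !in_itv/= andbT.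
have [x0|x0|->] := ltgtP x 0.
- by rewrite ltr0_sg// sub0r.
- by rewrite gtr0_sg// subr0.
- by rewrite sgr0 subr0.
Qed.

End power_bound.

Section characters.
Context (R : realType) (n : nat).
Local Notation Rn := (n.-tuple R).
Implicit Types (E J : {set 'I_n}) (x y : Rn) (t : 'I_n -> R).

(** The character of index J of the sign group, cut off to the points whose
coordinates in E are nonzero.  It is multiplicative ([chi_cmul]). *)
Definition chi E J x : R :=
  (\prod_(i in E) (tnth x i != 0)%:R) * \prod_(j in J) Num.sg (tnth x j).

Definition ell E t x : R := \sum_(i in E) t i * ln `|tnth x i|.

Definition absln E x : R := \sum_(i in E) `|ln `|tnth x i| |.

Definition absf E x : Rn := [tuple if i \in E then `|tnth x i| else 0 | i < n].

(** With the library convention ln 0 = 0 the factors other than chi are not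
meaningful on the axes, where chi vanishes. *)
Definition momf E J (a : R) t k x : R :=
  chi E J x * expR (a * ell E (fun=> 1) x) * ell E t x ^+ k.

Lemma measurable_coord i : measurable_fun setT (fun x : Rn => tnth x i).
Proof. exact: measurable_tnth. Qed.

Lemma measurable_lncoord i : measurable_fun setT (fun x : Rn => ln `|tnth x i|).
Proof.
apply: measurableT_comp; first exact: measurable_ln.
by apply: measurableT_comp => //; exact: measurable_coord.
Qed.

Lemma measurable_ell E t : measurable_fun setT (ell E t).
Proof.
rewrite /ell; under eq_fun do rewrite -big_filter.
apply: measurable_sum => i.
by apply: measurable_funM => //; exact: measurable_lncoord.
Qed.

Lemma chi_le1 E J x : `|chi E J x| <= 1.
Proof.
have prod_le1 (A : {set 'I_n}) (F : 'I_n -> R) : (forall i, `|F i| <= 1) ->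
    `|\prod_(i in A) F i| <= 1.
  move=> F1; apply: (big_ind (fun z : R => `|z| <= 1)) => // [|u v u1 v1].
    by rewrite normr1.
  by rewrite normrM mulr_ile1.
rewrite /chi normrM mulr_ile1//; apply: prod_le1 => i.
  by case: (_ != 0); rewrite ?normr1 ?normr0.
by rewrite normr_sg; case: (_ != 0).
Qed.

Lemma chi_eq0 E J x i : i \in E -> tnth x i = 0 -> chi E J x = 0.
Proof.
by move=> iE xi0; rewrite /chi (bigD1 i)//= xi0 eqxx mul0r mul0r.
Qed.

Lemma chi_neq0 E J x : chi E J x != 0 -> forall i, i \in E -> tnth x i != 0.
Proof. by move=> h i iE; apply: contra_neq h => /(chi_eq0 J iE). Qed.

Lemma bmeas_chi E J : bmeas (chi E J).
Proof.
split; last by exists 1 => x; exact: chi_le1.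
rewrite /chi; apply: measurable_funM.
  under eq_fun do rewrite -big_filter.
  apply: measurable_prod => i _.
  rewrite (_ : (fun x => _) = \1_(~` [set 0]) \o (fun x : Rn => tnth x i)).
    apply: measurableT_comp; last exact: measurable_coord.
    exact/measurable_indic/measurableC.
  apply/funext => x /=; rewrite indicE.
  have [xi0|/eqP xi0] := eqVneq (tnth x i) 0; last by rewrite mem_set.
  by rewrite memNset//= xi0; apply.
under eq_fun do rewrite -big_filter.
apply: measurable_prod => i _.
exact: (measurableT_comp (@measurable_fun_sgr R) (@measurable_coord i)).
Qed.

Lemma measurable_momf E J a t k : measurable_fun setT (momf E J a t k).
Proof.
apply: measurable_funM; last first.
  by apply: measurable_funX; exact: measurable_ell.
apply: measurable_funM; first by have [] := bmeas_chi E J.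
apply: measurableT_comp => //; apply: measurable_funM => //.
exact: measurable_ell.
Qed.

Lemma measurable_absf E : measurable_fun setT (absf E).
Proof.
apply/measurable_fun_tnthP => i; rewrite /absf.
rewrite (_ : _ \o _ = fun x : Rn => if i \in E then `|tnth x i| else 0).
  case: (i \in E) => //; apply: measurableT_comp => //; exact: measurable_coord.
by apply/funext => x /=; rewrite tnth_mktuple.
Qed.

Lemma measurable_norm2 : measurable_fun setT (@norm2 R n).
Proof.
rewrite /norm2; apply: measurableT_comp.
  by apply: continuous_measurable_fun; exact: sqrt_continuous.
by apply: measurable_sum => i; apply: measurable_funX; exact: measurable_coord.
Qed.

Lemma coord_le_norm2 x i : `|tnth x i| <= norm2 x.
Proof.
rewrite -sqrtr_sqr /norm2 ler_sqrt; last by apply: sumr_ge0 => j _; exact: sqr_ge0.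
by rewrite (bigD1 i)//= lerDl; apply: sumr_ge0 => j _; exact: sqr_ge0.
Qed.

Lemma norm2_ge0 x : 0 <= norm2 x.
Proof. exact: sqrtr_ge0. Qed.

Lemma absln_ge0 E x : 0 <= absln E x.
Proof. exact: sumr_ge0. Qed.

Lemma ell_le_absln E t x : `|ell E t x| <= (\sum_i `|t i|) * absln E x.
Proof.
rewrite /ell /absln big_distrr/= (le_trans (ler_norm_sum _ _ _))//.
apply: ler_sum => i iE; rewrite normrM ler_wpM2r//.
by rewrite (bigD1 i)//= lerDl; exact: sumr_ge0.
Qed.

(** Since u + |u| is 2 max(u, 0), only the coordinates with |x_i| > 1 contribute
to the exponent, each at most 2 a ln(1 + |x|); there are at most n of them and
2 a n <= 1. *)
Lemma weight_le E J (a : R) x : 0 <= a -> 2 * a * n%:R <= 1 ->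
  `|chi E J x| * expR (a * ell E (fun=> 1) x + a * absln E x) <= 1 + norm2 x.
Proof.
move=> a0 an.
have N0 := norm2_ge0 x.
have [->|/chi_neq0 xE] := eqVneq (chi E J x) 0.
  by rewrite normr0 mul0r; lra.
rewrite -[leRHS]mul1r; apply: ler_pM => //; rewrite ?expR_ge0 ?chi_le1//.
have H0 : 0 < 1 + norm2 x by lra.
have L0 : 0 <= ln (1 + norm2 x) by rewrite ln_ge0//; lra.
rewrite -[leRHS]lnK ?posrE// ler_expR -mulrDr /ell /absln -big_split/=.
apply: (@le_trans _ _ (a * \sum_(i in E) (2 * ln (1 + norm2 x)))).
  rewrite ler_wpM2l//; apply: ler_sum => i iE; rewrite mul1r.
  have : ln `|tnth x i| <= ln (1 + norm2 x).
    rewrite ler_ln ?posrE ?normr_gt0 ?xE//.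
    by have := coord_le_norm2 x i; lra.
  by have [] := ger0P (ln `|tnth x i|); lra.
rewrite sumr_const -[_ *+ #|E|]mulr_natr.
have Ln : #|E|%:R <= n%:R :> R by rewrite ler_nat -[leqRHS]card_ord max_card.
have : a * 2 * #|E|%:R <= 1.
  by apply: le_trans an; rewrite [2 * a]mulrC ler_wpM2l// mulr_ge0.
move=> /(ler_wpM2r L0); rewrite [leRHS]mul1r => h; apply: le_trans h.
by rewrite le_eqVlt; apply/orP; left; apply/eqP; ring.
Qed.

(** The exponential factor on the left is what makes power series in the
logarithms integrable term by term; half of the reserve a |u| of [weight_le]
pays for it and the other half for the powers. *)
Lemma momf_bound E J (a : R) t t' k m : 0 < a -> 2 * a * n%:R <= 1 ->
  exists C, forall x, `|momf E J a t k x| * `|ell E t' x| ^+ m *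
    expR (a / 2 * absln E x) <= C * (1 + norm2 x).
Proof.
move=> a0 an; have a20 : 0 < a / 2 by rewrite divr_gt0.
pose ct : R := \sum_i `|t i|; pose ct' : R := \sum_i `|t' i|.
have ct0 : 0 <= ct by exact: sumr_ge0.
have ct'0 : 0 <= ct' by exact: sumr_ge0.
exists (ct ^+ k * ct' ^+ m * ((k + m)`!%:R / (a / 2) ^+ (k + m))) => x.
have L0 := absln_ge0 E x.
rewrite /momf normrM normrM normrX (ger0_norm (expR_ge0 _)).
have W := weight_le E J x (ltW a0) an.
set K := _`!%:R / _.
have K0 : 0 <= K by rewrite divr_ge0// exprn_ge0// ltW.
have h1 : `|ell E t x| ^+ k <= ct ^+ k * absln E x ^+ k.
  by rewrite -exprMn lerXn2r ?nnegrE ?mulr_ge0// ell_le_absln.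
have h2 : `|ell E t' x| ^+ m <= ct' ^+ m * absln E x ^+ m.
  by rewrite -exprMn lerXn2r ?nnegrE ?mulr_ge0// ell_le_absln.
have h3 : absln E x ^+ (k + m) <= K * expR (a / 2 * absln E x).
  exact: exprn_le_expR.
set u : R := `|ell E t x| ^+ k in h1 *; set v : R := `|ell E t' x| ^+ m in h2 *.
have u0 : 0 <= u by rewrite exprn_ge0.
have v0 : 0 <= v by rewrite exprn_ge0.
set w := expR (a / 2 * _) in h3 *.
have w0 : 0 <= w by exact: expR_ge0.
have h4 : u * v <= ct ^+ k * ct' ^+ m * K * w.
  apply: (le_trans (ler_pM u0 v0 h1 h2)).
  rewrite mulrACA -exprD -[leRHS]mulrA; apply: ler_wpM2l => //.
  by rewrite mulr_ge0// exprn_ge0.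
set c : R := `|chi E J x| in W *; set e := expR (a * ell E _ x).
rewrite (_ : c * e * u * v * w = (u * v) * (c * e * w)); last by ring.
have e0 : 0 <= e by exact: expR_ge0.
have c0 : 0 <= c by exact: normr_ge0.
have cew : 0 <= c * e * w by rewrite !mulr_ge0.
apply: (le_trans (ler_wpM2r cew h4)).
rewrite (_ : _ * _ * K * w * _ = ct ^+ k * ct' ^+ m * K * (c * (e * (w * w)))); last by ring.
apply: ler_wpM2l.
  apply: mulr_ge0 => //; apply: mulr_ge0; exact: exprn_ge0.
apply: le_trans W; rewrite /e /w -!expRD; apply: ler_wpM2l => //.
by rewrite ler_expR -mulrDl -splitr.
Qed.

End characters.

(** * Convolution and product measures *)

Section product_integrals.
Context d1 d2 (T1 : measurableType d1) (T2 : measurableType d2) (R : realType).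
Variables (m1 : {finite_measure set T1 -> \bar R}).
Variables (m2 : {finite_measure set T2 -> \bar R}).

Lemma intg_prod (g : T1 -> R) (h : T2 -> R) : intg m1 g -> intg m2 h ->
  intg (m1 \x m2)%E (fun z => g z.1 * h z.2).
Proof.
move=> ig ih.
have mg := intg_measurable ig; have mh := intg_measurable ih.
apply/integrable12ltyP.
  apply/measurable_EFinP; apply: measurable_funM;
  exact: measurableT_comp.
have Eh x : (\int[m2]_y `|(g x * h y)%:E| = (`|g x| * \int[m2]_y `|h y|)%:E)%E.
  rewrite /Rintegral -RintegralZl//; last exact: integrable_norm.
  rewrite /Rintegral fineK; first by apply: eq_integral => y _; rewrite /= normrM.
  exact/integrable_fin_num/intgZ/integrable_norm.
under eq_integral do rewrite Eh.
apply: integrable_lty => //.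
have := intgZ (\int[m2]_y `|h y|) (integrable_norm ig).
by apply: eq_integrable => // x _ /=; rewrite mulrC.
Qed.

Lemma Rintegral_prod (f : T1 * T2 -> R) : intg (m1 \x m2)%E f ->
  (forall x, intg m2 (fun y => f (x, y))) ->
  intg m1 (fun x => \int[m2]_y f (x, y)) /\
  \int[m1]_x \int[m2]_y f (x, y) = \int[(m1 \x m2)%E]_z f z.
Proof.
move=> If Ify.
have E x : fubini_F m2 (EFin \o f) x = (\int[m2]_y f (x, y))%:E.
  by rewrite /fubini_F /Rintegral fineK//; exact/integrable_fin_num/Ify.
split.
  apply: eq_integrable (integrable_fubini_F If) => // x _; exact: E.
rewrite /Rintegral; congr fine; rewrite -integral12_prod_meas1//.
by apply: eq_integral => x _; rewrite E.
Qed.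

End product_integrals.

Section convolution.
Context (R : realType) (n : nat).
Local Notation Rn := (n.-tuple R).
Implicit Types (nu mu : {charge set Rn -> \bar R}) (x y : Rn).

Lemma measurable_cmul : measurable_fun setT (fun z : Rn * Rn => cmul z.1 z.2).
Proof.
apply/measurable_fun_tnthP => i.
rewrite (_ : _ \o _ = fun z : Rn * Rn => tnth z.1 i * tnth z.2 i).
  apply: measurable_funM.
    exact: (measurableT_comp (@measurable_coord R n i) measurable_fst).
  exact: (measurableT_comp (@measurable_coord R n i) measurable_snd).
by apply/funext => z /=; rewrite tnth_mktuple.
Qed.

Lemma measurable_cmulr x : measurable_fun setT (cmul x).
Proof.
apply/measurable_fun_tnthP => i.
rewrite (_ : _ \o _ = fun y : Rn => tnth x i * tnth y i).
  by apply: measurable_funM => //; exact: measurable_coord.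
by apply/funext => z /=; rewrite tnth_mktuple.
Qed.

Lemma sint_prod nu mu (f : Rn * Rn -> R) :
  intg (tv nu \x tv mu)%E f -> (forall x, intg (tv mu) (fun y => f (x, y))) ->
  intg (tv nu) (fun x => sint mu (fun y => f (x, y))) /\
  sint nu (fun x => sint mu (fun y => f (x, y))) =
  \int[(tv nu \x tv mu)%E]_z (hsign nu z.1 * hsign mu z.2 * f z).
Proof.
move=> If Ify.
pose F (z : Rn * Rn) := hsign nu z.1 * hsign mu z.2 * f z.
have [msn _] := bmeas_hsign nu; have [msm _] := bmeas_hsign mu.
have IF : intg (tv nu \x tv mu)%E F.
  refine (@intg_le _ _ _ _ F (fun z => `|f z|) 1 _ _ _).
  - apply: measurable_funM; last exact: intg_measurable If.
    by apply: measurable_funM; apply: measurableT_comp.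
  - exact: integrable_norm.
  - by move=> x; rewrite !normrM !normr_hsign !mul1r.
have IFy x : intg (tv mu) (fun y => F (x, y)).
  apply: eq_integrable (intgZ (hsign nu x) (intg_hsign (Ify x))) => // y _.
  by rewrite /F /= mulrA.
have [I1 <-] := Rintegral_prod IF IFy.
have E x : \int[tv mu]_y F (x, y) = hsign nu x * sint mu (fun y => f (x, y)).
  rewrite -RintegralZl//; last exact: intg_hsign.
  by apply: eq_Rintegral => y _; rewrite /F /= mulrA.
split; last by apply: eq_Rintegral => x _; rewrite E.
apply: eq_integrable (intg_hsign I1) => // x _ /=.
have s2 : hsign nu x * hsign nu x = 1.
  by rewrite -expr2 -real_normK ?num_real// normr_hsign expr1n.
by rewrite E mulrA s2 mul1r.
Qed.

Lemma intg_prod_bounded nu mu (f : Rn * Rn -> R) : bmeas f ->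
  intg (tv nu \x tv mu)%E f.
Proof.
move=> [mf [M fM]].
apply: (@intg_le _ _ _ _ _ (fun z => cst 1 z.1 * cst 1 z.2) M) => //.
  by apply: intg_prod; apply: intg_finite; exact: bmeas_cst.
by move=> x; rewrite /= !mulr1.
Qed.

Lemma bmeas_sint_prod nu mu (f : Rn * Rn -> R) : bmeas f ->
  bmeas (fun x => sint mu (fun y => f (x, y))).
Proof.
move=> bf; have [mf [M fM]] := bf.
have bfy x : bmeas (fun y => f (x, y)).
  by split; [exact: measurableT_comp | exists M].
have [If _] := sint_prod (intg_prod_bounded nu mu bf) (fun x => intg_finite _ (bfy x)).
split; first exact: intg_measurable If.
exists (M * fine (tv mu setT)) => x.
have Is := intg_hsign (intg_finite (tv mu) (bfy x)).
apply: le_trans (le_normr_Rintegral measurableT Is) _.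
rewrite -Rintegral_cst//; apply: le_Rintegral => //.
- exact: integrable_norm.
- exact/intg_finite/bmeas_cst.
- by move=> y _; rewrite normrM normr_hsign mul1r.
Qed.

Lemma mconv_sint nu mu A : measurable A ->
  mconv nu mu A = (sint nu (fun x => sint mu (fun y => \1_A (cmul x y))))%:E.
Proof.
move=> mA; rewrite /mconv.
have b1 : bmeas (fun z : Rn * Rn => \1_A (cmul z.1 z.2) : R).
  by apply: (bmeas_comp measurable_cmul); exact: bmeas_indic.
rewrite -cintegral_sint; last exact: (bmeas_sint_prod nu mu b1).
congr (cintegral nu _); apply/funext => x /=; rewrite -cintegral_sint//.
by apply: bmeas_comp; [exact: measurable_cmulr | exact: bmeas_indic].
Qed.

(** The null set function nu * mu is the image of a signed measure on the product
space, so it also annihilates the unbounded integrable functions. *)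
Lemma mconv_null_integral nu mu (F : Rn -> R) :
  is_null (mconv nu mu) -> measurable_fun setT F ->
  intg (tv nu \x tv mu)%E (fun z => F (cmul z.1 z.2)) ->
  \int[(tv nu \x tv mu)%E]_z (hsign nu z.1 * hsign mu z.2 * F (cmul z.1 z.2)) = 0.
Proof.
move=> null mF IF.
have [msn _] := bmeas_hsign nu; have [msm _] := bmeas_hsign mu.
have mss : measurable_fun setT (fun z : Rn * Rn => hsign nu z.1 * hsign mu z.2).
  by apply: measurable_funM; apply: measurableT_comp.
have nss z : `|hsign nu z.1 * hsign mu z.2| = 1 by rewrite normrM !normr_hsign mul1r.
apply: (@Rintegral_image_eq0 _ _ _ _ _ (tv nu \x tv mu)%E
    (fun z : Rn * Rn => hsign nu z.1 * hsign mu z.2)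
    (fun z : Rn * Rn => cmul z.1 z.2)) => //.
- by apply: intg_prod_bounded; split => //; exists 1 => z; rewrite nss.
- exact: measurable_cmul.
- move=> B mB; have b1 : bmeas (fun z : Rn * Rn => \1_B (cmul z.1 z.2) : R).
    by apply: (bmeas_comp measurable_cmul); exact: bmeas_indic.
  rewrite -(sint_prod (intg_prod_bounded nu mu b1) _).2; last first.
    move=> x; apply: intg_finite.
    by apply: bmeas_comp; [exact: measurable_cmulr | exact: bmeas_indic].
  by apply: EFin_inj; rewrite -mconv_sint// null.
- apply: (@intg_le _ _ _ _ _ (fun z => `|F (cmul z.1 z.2)|) 1).
  + by apply: measurable_funM => //; exact: measurableT_comp measurable_cmul.
  + exact: integrable_norm.
  + by move=> z; rewrite normrM nss.
Qed.

End convolution.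

(** * Moments of a component *)

Lemma poly_all_roots (R : numDomainType) (p : {poly R}) :
  (forall s, p.[s] = 0) -> p = 0.
Proof.
move=> p0; apply/eqP/negPn/negP => pn0.
pose rs := [seq (i%:R : R) | i <- iota 0 (size p)].
have := max_poly_roots pn0 (rs := rs).
rewrite size_map size_iota ltnn => H; apply/notF/H.
  by apply/allP => s _; rewrite /root p0.
by rewrite map_inj_uniq ?iota_uniq// => i j /eqP; rewrite eqr_nat => /eqP.
Qed.

Section moments.
Context (R : realType) (n : nat) (E J : {set 'I_n}) (a : R).
Hypotheses (a0 : 0 < a) (an : 2 * a * n%:R <= 1).
Local Notation Rn := (n.-tuple R).
Local Notation charges := ({charge set Rn -> \bar R}).
Implicit Types (nu mu : charges) (x y : Rn) (t : 'I_n -> R) (h : Rn -> R).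

Definition has_moment nu := intg (tv nu) (fun x => 1 + norm2 x).

Lemma intg_momfM nu t k t' m h : has_moment nu -> bmeas h ->
  intg (tv nu) (fun x => h x * (momf E J a t k x * ell E t' x ^+ m)).
Proof.
move=> nuH [mh [M hM]].
have [C HC] := momf_bound E J t t' k m a0 an.
apply: (@intg_le _ _ _ _ _ _ (`|M| * C) _ nuH).
  apply: measurable_funM => //; apply: measurable_funM.
    exact: measurable_momf.
  by apply: measurable_funX; exact: measurable_ell.
move=> x; rewrite normrM -[leRHS]mulrA; apply: ler_pM => //.
  exact: le_trans (hM x) (ler_norm M).
apply: le_trans (HC x); rewrite normrM normrX -[leLHS]mulr1.
by apply: ler_wpM2l => //; rewrite -[leLHS](@expR0 R) ler_expR mulr_ge0 ?absln_ge0// divr_ge0// ltW.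
Qed.

Lemma intg_momf nu t k : has_moment nu -> intg (tv nu) (momf E J a t k).
Proof.
move=> nuH.
apply: eq_integrable (intg_momfM t k t 0 nuH (bmeas_cst _ 1)) => // x _ /=.
by rewrite expr0 mulr1 mul1r.
Qed.

Lemma ell_cmul t x y : (forall i, i \in E -> tnth x i != 0) ->
  (forall i, i \in E -> tnth y i != 0) ->
  ell E t (cmul x y) = ell E t x + ell E t y.
Proof.
move=> xE yE; rewrite /ell -big_split/=; apply: eq_bigr => i iE.
by rewrite tnth_mktuple normrM lnM ?posrE ?normr_gt0 ?xE ?yE// mulrDr.
Qed.

Lemma chi_cmul x y : chi E J (cmul x y) = chi E J x * chi E J y.
Proof.
rewrite /chi mulrACA -!big_split/=; congr (_ * _); apply: eq_bigr => i _.
  by rewrite tnth_mktuple mulf_eq0 negb_or -natrM mulnb.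
by rewrite tnth_mktuple sgrM.
Qed.

(** Both sides vanish if one of x, y has a zero coordinate in E; otherwise the
logarithms add up and this is the binomial formula. *)
Lemma momf_cmul t k x y : momf E J a t k (cmul x y) =
  \sum_(j < k.+1) 'C(k, j)%:R * (momf E J a t (k - j) x * momf E J a t j y).
Proof.
rewrite /momf chi_cmul.
have [->|/chi_neq0 xE] := eqVneq (chi E J x) 0.
  by rewrite !mul0r big1// => j _; rewrite !mul0r mulr0.
have [->|/chi_neq0 yE] := eqVneq (chi E J y) 0.
  by rewrite mulr0 !mul0r big1// => j _; rewrite !mul0r !mulr0.
rewrite !ell_cmul// mulrDr expRD exprDn big_distrr/=.
by apply: eq_bigr => j _; rewrite -mulr_natr; ring.
Qed.

Definition moment nu t k := sint nu (momf E J a t k).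

Lemma moment_conv nu mu t k : has_moment nu -> has_moment mu ->
  is_null (mconv nu mu) ->
  \sum_(j < k.+1) 'C(k, j)%:R * (moment nu t (k - j) * moment mu t j) = 0.
Proof.
move=> nuH muH null.
pose f (j : 'I_k.+1) (z : Rn * Rn) :=
  momf E J a t (k - j) z.1 * momf E J a t j z.2.
have If j : intg (tv nu \x tv mu)%E (f j) by apply: intg_prod; exact: intg_momf.
have IF : intg (tv nu \x tv mu)%E (fun z => momf E J a t k (cmul z.1 z.2)).
  apply: eq_integrable
    (intg_sum (index_enum _) (fun j : 'I_k.+1 => intgZ ('C(k, j)%:R) (If j))) => //.
  by move=> z _; rewrite /= momf_cmul.
have := mconv_null_integral null (measurable_momf E J a t k) IF.
have Ifs j : intg (tv nu \x tv mu)%E (fun z => hsign nu z.1 * hsign mu z.2 * f j z).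
  have [msn _] := bmeas_hsign nu; have [msm _] := bmeas_hsign mu.
  apply: (@intg_le _ _ _ _ _ (fun z => `|f j z|) 1).
  - apply: measurable_funM; last exact: intg_measurable (If j).
    by apply: measurable_funM; apply: measurableT_comp.
  - exact: integrable_norm (If j).
  - by move=> z; rewrite 2!normrM !normr_hsign !mul1r.
have -> : \int[(tv nu \x tv mu)%E]_z
      (hsign nu z.1 * hsign mu z.2 * momf E J a t k (cmul z.1 z.2)) =
    \int[(tv nu \x tv mu)%E]_z (\sum_(j < k.+1)
      'C(k, j)%:R * (hsign nu z.1 * hsign mu z.2 * f j z)).
  apply: eq_Rintegral => z _; rewrite momf_cmul big_distrr/=.
  by apply: eq_bigr => j _; rewrite /f; ring.
rewrite Rintegral_sum; last by move=> j; exact: intgZ.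
move=> H; rewrite -[RHS]H; apply: eq_bigr => j _; rewrite RintegralZl//; last exact: Ifs.
congr (_ * _).
rewrite -(sint_prod (If j) _).2; last first.
  by move=> x; exact: (intgZ (momf E J a t (k - j) x) (intg_momf t j muH)).
rewrite /f /= /moment -[RHS]/(sint _ _).
rewrite mulrC -sintZ; last exact: intg_momf.
congr sint; apply/funext => x; rewrite sintZ; last exact: intg_momf.
by rewrite mulrC.
Qed.

Lemma ell_line t t' (s : R) x :
  ell E (fun i => t i + s * t' i) x = ell E t x + s * ell E t' x.
Proof.
rewrite /ell big_distrr -big_split/=; apply: eq_bigr => i _; ring.
Qed.

(** The moment of order k along the line t + s t', as a polynomial in s. *)
Definition moment_poly nu h t t' k : {poly R} :=
  \poly_(j < k.+1) ('C(k, j)%:R *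
    sint nu (fun x => h x * (momf E J a t (k - j) x * ell E t' x ^+ j))).

Lemma moment_polyE nu h t t' k s : has_moment nu -> bmeas h ->
  sint nu (fun x => h x * momf E J a (fun i => t i + s * t' i) k x) =
  (moment_poly nu h t t' k).[s].
Proof.
move=> nuH bh; rewrite horner_poly.
under eq_bigr do rewrite mulrAC -sintZ ?intg_momfM//.
rewrite -sint_sum; last by move=> j; apply/intgZ/intg_momfM.
congr sint; apply/funext => x; rewrite /momf ell_line.
move: (chi E J x * _) (ell E t x) (ell E t' x) => c u v.
rewrite exprDn !big_distrr/=.
by apply: eq_bigr => j _; rewrite -mulr_natr exprMn; ring.
Qed.

(** A mixed moment is, up to a binomial coefficient, a coefficient of
[moment_poly]. *)
Lemma moment_polarize nu h t t' k m : has_moment nu -> bmeas h ->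
  (forall t k, sint nu (fun x => h x * momf E J a t k x) = 0) ->
  sint nu (fun x => h x * (momf E J a t k x * ell E t' x ^+ m)) = 0.
Proof.
move=> nuH bh h0.
have := @poly_all_roots _ (moment_poly nu h t t' (k + m)) _.
move=> /(_ _)/(congr1 (fun p : {poly R} => p`_m)).
rewrite coef0 coef_poly ltnS leq_addl addnK => H.
apply: (@mulfI _ 'C(k + m, m)%:R).
  by rewrite pnatr_eq0 -lt0n bin_gt0 leq_addl.
by rewrite mulr0 H// => s; rewrite -moment_polyE.
Qed.

(** Leading terms do not cancel: if k and l are the least orders at which the
moments of nu and mu are not identically zero, the binomial formula at order
k + l has a single nonzero term.  Restricting to the line joining t, where the
first does not vanish, to t', where the second does not, reduces the question
to polynomials in one variable. *)
Lemma moment_dichotomy nu mu : has_moment nu -> has_moment mu ->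
  is_null (mconv nu mu) ->
  (forall t k, moment nu t k = 0) \/ (forall t k, moment mu t k = 0).
Proof.
move=> nuH muH null.
have first_nonzero (c : charges) : ~ (forall t k, moment c t k = 0) ->
    exists k t, moment c t k != 0 /\ forall t' j, (j < k)%N -> moment c t' j = 0.
  move=> c0.
  have exk : exists k, `[< exists t, moment c t k != 0 >].
    apply: contrapT => nk; apply: c0 => t k; apply/eqP; apply: contrapT => tk.
    by apply: nk; exists k; apply/asboolP; exists t; apply/negP.
  case: (ex_minnP exk) => k /asboolP[t tk] kmin; exists k, t; split=> // t' j jk.
  apply/eqP; apply: contraTT jk => jt'; rewrite -leqNgt; apply: kmin.
  by apply/asboolP; exists t'.
apply: contrapT => /not_orP[/first_nonzero[k [t [tk kmin]]]].
move=> /first_nonzero[l [t' [t'l lmin]]].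
(* a term of the sum with j < l has a null moment of mu, one with j > l a null
   moment of nu *)
have prod0 u : moment nu u k * moment mu u l = 0.
  have := moment_conv u (k + l) nuH muH null.
  have lkl : (l < (k + l).+1)%N by rewrite ltnS leq_addl.
  rewrite (bigD1 (Ordinal lkl))//= big1 => [|j jl].
    rewrite addr0 addnK => /eqP; rewrite mulf_eq0 pnatr_eq0 -leqn0 leqNgt.
    by rewrite bin_gt0 leq_addl/= => /eqP.
  have [jl'|lj] := ltnP j l; first by rewrite lmin// !mulr0.
  rewrite kmin ?mul0r ?mulr0//.
  have lj' : (l < j)%N.
    rewrite ltn_neqAle lj andbT; apply: contra jl => /eqP ljE.
    by apply/eqP/val_inj.
  have jle : (j <= k + l)%N by rewrite -ltnS ltn_ord.
  by rewrite ltn_subLR// [(j + k)%N]addnC ltn_add2l.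
pose p := moment_poly nu (cst 1) t (fun i => t' i - t i) k.
pose q := moment_poly mu (cst 1) t (fun i => t' i - t i) l.
have momE (c : charges) u r : has_moment c -> moment c u r =
    sint c (fun x => cst 1 x * momf E J a u r x).
  by move=> _; congr sint; apply/funext => x; rewrite mul1r.
have pE s : p.[s] = moment nu (fun i => t i + s * (t' i - t i)) k.
  by rewrite -moment_polyE ?momE//; exact: bmeas_cst.
have qE s : q.[s] = moment mu (fun i => t i + s * (t' i - t i)) l.
  by rewrite -moment_polyE ?momE//; exact: bmeas_cst.
have /eqP : p * q = 0 by apply: poly_all_roots => s; rewrite hornerM pE qE.
rewrite mulf_eq0 => /orP[/eqP p0|/eqP q0].
  move: (pE 0); rewrite p0 horner0 => h; move: tk.
  rewrite (_ : t = fun i => t i + 0 * (t' i - t i)) -?h ?eqxx//.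
  by apply/funext => i; rewrite mul0r addr0.
move: (qE 1); rewrite q0 horner0 => h; move: t'l.
rewrite (_ : t' = fun i => t i + 1 * (t' i - t i)) -?h ?eqxx//.
by apply/funext => i; rewrite mul1r addrC subrK.
Qed.

End moments.

(** * A polynomial iteration converging to the sign function *)

Section sign_iteration.
Variable R : realType.
Implicit Types s : R.

(** Its fixed points are -1, 0 and 1, and -1 and 1 are attracting; being
polynomial, it does not leave an algebra of functions. *)
Definition signstep s : R := (3 * s - s ^+ 3) / 2.

Lemma signstepN s : signstep (- s) = - signstep s.
Proof. by rewrite /signstep; lra. Qed.

Lemma iter_signstepN k s : iter k signstep (- s) = - iter k signstep s.
Proof. by elim: k => //= k ->; rewrite signstepN. Qed.

Lemma signstep_itv s : 0 <= s <= 1 -> s <= signstep s <= 1.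
Proof. move=> /andP[s0 s1]; rewrite /signstep.
have h1 : 0 <= s * (1 - s) * (1 + s) by rewrite !mulr_ge0//; lra.
have h2 : 0 <= (1 - s) ^+ 2 * (2 + s) by rewrite mulr_ge0 ?sqr_ge0//; lra.
by apply/andP; split; lra. Qed.

Lemma iter_signstep_itv k s : 0 <= s <= 1 -> s <= iter k signstep s <= 1.
Proof.
move=> /andP[s0 s1]; elim: k => [|k /andP[ih1 ih2]]; first by rewrite lexx.
have /andP[h1 h2] := @signstep_itv (iter k signstep s) ltac:(lra).
by rewrite /= h2 (le_trans ih1 h1).
Qed.

Lemma iter_signstep_le1 k s : `|s| <= 1 -> `|iter k signstep s| <= 1.
Proof.
move=> s1; have [s0|s0] := leP 0 s.
  have := @iter_signstep_itv k s; rewrite -{2}(ger0_norm s0) s0 s1.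
  by move=> /(_ isT)/andP[h1 h2]; rewrite ger0_norm// (le_trans s0).
have := @iter_signstep_itv k (- s).
have := s1; rewrite ltr0_norm// => s1'; rewrite s1' oppr_ge0 ltW// iter_signstepN.
move=> /(_ isT)/andP[h1 h2]; rewrite ler0_norm//.
by move: s0 h1 => *; lra.
Qed.

Lemma iter_signstep_cvg_pos s : 0 < s <= 1 ->
  iter k signstep s @[k --> \oo] --> (1 : R).
Proof.
move=> /andP[s0 s1].
(* 1 - signstep u = (1 - u)^2 (2 + u) / 2 is at most (1 - u) (1 - s / 2) for
   s <= u <= 1, so the distance to 1 decreases geometrically *)
have rate k : 1 - (1 - s / 2) ^+ k <= iter k signstep s.
  elim: k => [|k ih]; first by rewrite expr0 subrr ltW.
  have := @iter_signstep_itv k s; rewrite s1 ltW// => /(_ isT)/andP[h1 h2].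
  rewrite iterS exprS; set u := iter k _ _ in ih h1 h2 *.
  set c := (1 - s / 2) ^+ k in ih *.
  have c0 : 0 <= c by apply: exprn_ge0; lra.
  have : 1 - signstep u <= (1 - u) * (1 - s / 2) by rewrite /signstep; nra.
  by move=> h; nra.
have g0 : (1 - s / 2) ^+ k @[k --> \oo] --> (0 : R).
  by apply: cvg_expr; rewrite ger0_norm; lra.
apply: (@squeeze_cvgr _ _ _ _ (fun k => 1 - (1 - s / 2) ^+ k) (cst 1)).
- apply: nearW => k; rewrite rate/=.
  by have := @iter_signstep_itv k s; rewrite s1 ltW// => /(_ isT)/andP[].
- by rewrite -[X in _ --> X]subr0; apply: cvgB => //; exact: cvg_cst.
- exact: cvg_cst.
Qed.

Lemma iter_signstep_cvg s : `|s| <= 1 ->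
  iter k signstep s @[k --> \oo] --> Num.sg s.
Proof.
move=> s1; have [s0|s0|->] := ltgtP s 0.
- rewrite ltr0_sg//; rewrite -[s]opprK; under eq_fun do rewrite iter_signstepN.
  by apply: cvgN; apply: iter_signstep_cvg_pos; move: s1; rewrite ltr0_norm//; lra.
- rewrite gtr0_sg//; apply: iter_signstep_cvg_pos.
  by move: s1; rewrite gtr0_norm//; lra.
- rewrite sgr0; rewrite (_ : (fun k => _) = cst 0); first exact: cvg_cst.
  apply/funext => k; elim: k => //= k ->.
  by rewrite /signstep mulr0 expr0n subr0 mul0r.
Qed.

End sign_iteration.

(** * A component is determined by its moments *)

Section determinacy.
Context (R : realType) (n : nat) (E J : {set 'I_n}) (a : R).
Hypotheses (a0 : 0 < a) (an : 2 * a * n%:R <= 1).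
Local Notation Rn := (n.-tuple R).
Variable nu : {charge set Rn -> \bar R}.
Hypothesis nuH : has_moment nu.
Implicit Types (x y : Rn) (t : 'I_n -> R) (g h : Rn -> R).

Definition moment_free h := bmeas h /\
  forall t k, sint nu (fun x => h x * momf E J a t k x) = 0.

Definition multiplier g := bmeas g /\ forall h, moment_free h -> moment_free (fun x => h x * g x).

Lemma intgM_momf h t k : bmeas h -> intg (tv nu) (fun x => h x * momf E J a t k x).
Proof.
move=> bh.
apply: eq_integrable (intg_momfM E J a0 an t k t 0 nuH bh) => // x _ /=.
by rewrite expr0 mulr1.
Qed.

Lemma moment_free_lim (h_ : nat -> Rn -> R) (M : R) h : (forall m, moment_free (h_ m)) ->
  (forall m x, `|h_ m x| <= M) -> (forall x, h_ m x @[m --> \oo] --> h x) ->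
  moment_free h.
Proof.
move=> Vh hM hh; split.
  apply: bmeas_lim hM hh => m; by have [] := Vh m.
move=> t k.
apply: (@sint_eq0_lim _ _ _ nu (fun m x => h_ m x * momf E J a t k x) _
  (fun x => M * `|momf E J a t k x|)).
- move=> m; have [[mh _] _] := Vh m.
  by apply: measurable_funM => //; exact: measurable_momf.
- by apply/intgZ/integrable_norm/intg_momf.
- by move=> m x; rewrite normrM ler_wpM2r.
- by move=> x; apply: cvgMl; exact: hh.
- by move=> m; have [] := Vh m.
Qed.

Lemma multiplier_lim (g_ : nat -> Rn -> R) (M : R) g : (forall m, multiplier (g_ m)) ->
  (forall m x, `|g_ m x| <= M) -> (forall x, g_ m x @[m --> \oo] --> g x) ->
  multiplier g.
Proof.
move=> Dg gM gg; split.
  apply: bmeas_lim gM gg => m; by have [] := Dg m.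
move=> h Vh; have [[mh [N hN]] _] := Vh.
apply: (@moment_free_lim (fun m x => h x * g_ m x) (N * M)).
- by move=> m; have [_] := Dg m; exact.
- by move=> m x; rewrite normrM ler_pM.
- by move=> x; apply: cvgMr; exact: gg.
Qed.

Lemma multiplier_cst c : multiplier (cst c).
Proof.
split; first exact: bmeas_cst.
move=> h [bh h0]; split; first by apply: bmeasM => //; exact: bmeas_cst.
move=> t k; rewrite -[RHS](mulr0 c) -(h0 t k) -sintZ; last exact: intgM_momf.
by congr sint; apply/funext => x /=; ring.
Qed.

Lemma multiplierD g1 g2 : multiplier g1 -> multiplier g2 -> multiplier (fun x => g1 x + g2 x).
Proof.
move=> [b1 D1] [b2 D2]; split; first exact: bmeasD.
move=> h Vh; have [bh _] := Vh; have [b1' h1] := D1 _ Vh; have [b2' h2] := D2 _ Vh.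
split; first by apply: bmeasM => //; exact: bmeasD.
move=> t k; rewrite -[RHS](addr0 0) -{1}(h1 t k) -(h2 t k) -sintD; try exact: intgM_momf.
by congr sint; apply/funext => x /=; ring.
Qed.

Lemma multiplierM g1 g2 : multiplier g1 -> multiplier g2 -> multiplier (fun x => g1 x * g2 x).
Proof.
move=> [b1 D1] [b2 D2]; split; first exact: bmeasM.
move=> h Vh; have := D2 _ (D1 _ Vh).
rewrite (_ : (fun x => _) = (fun x => h x * (g1 x * g2 x)))//.
by apply/funext => x; rewrite mulrA.
Qed.

Lemma multiplierZ c g : multiplier g -> multiplier (fun x => c * g x).
Proof. exact/multiplierM/multiplier_cst. Qed.

(** Each partial sum of the series is a polynomial in ln |x_i|, which multiplies
moments into mixed moments; the partial sums are dominated by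
exp(a / 2 |ln |x_i||), which [momf_bound] allows. *)
Lemma multiplier_series (c : nat -> R) (phi : R -> R) i : i \in E ->
  (forall m, `|c m| <= (m`!%:R)^-1) ->
  (forall u, series (fun m => c m * u ^+ m) N @[N --> \oo] --> phi u) ->
  (forall u, `|phi u| <= 1) -> measurable_fun setT phi ->
  forall del, `|del| <= a / 2 -> multiplier (fun x => phi (del * ln `|tnth x i|)).
Proof.
move=> iE c1 cphi phi1 mphi del dela.
have bphi : bmeas (fun x : Rn => phi (del * ln `|tnth x i|)).
  split; last by exists 1 => x.
  apply: (measurableT_comp mphi); apply: measurable_funM => //.
  exact: measurable_lncoord.
split=> // h [bh h0]; split; first exact: bmeasM.
move=> t k; have [mh [M hM]] := bh.
(* the direction for which ell is the i-th logarithm *)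
pose ei (j : 'I_n) : R := (j == i)%:R.
have ellE x : ell E ei x = ln `|tnth x i|.
  rewrite /ell (bigD1 i)//= /ei eqxx mul1r big1 ?addr0// => j /andP[_ /negbTE ->].
  by rewrite mul0r.
pose ps N x : R := series (fun m => c m * (del * ln `|tnth x i|) ^+ m) N.
have psE N x : h x * ps N x * momf E J a t k x = \sum_(m <- index_iota 0 N)
    (c m * del ^+ m) * (h x * (momf E J a t k x * ell E ei x ^+ m)).
  rewrite /ps /series /= [h x * _]mulrC -mulrA big_distrl/=.
  by apply: eq_bigr => m _; rewrite ellE exprMn; ring.
have [C HC] := momf_bound E J t t k 0 a0 an.
apply: (@sint_eq0_lim _ _ _ nu (fun N x => h x * ps N x * momf E J a t k x) _
  (fun x => `|M| * C * (1 + norm2 x))).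
- move=> N; under eq_fun do rewrite psE.
  by apply: measurable_sum => m; apply: (@intg_measurable _ _ _ (tv nu)); apply/intgZ/intg_momfM.
- exact/intgZ/nuH.
- move=> N x; rewrite -mulrA normrM -mulrA; apply: ler_pM => //.
    exact: le_trans (hM x) (ler_norm M).
  apply: le_trans (HC x); rewrite expr0 mulr1 normrM mulrC.
  apply: ler_wpM2l => //.
  have h1 : `|ps N x| <= series (exp_coeff `|del * ln `|tnth x i| |) N.
    rewrite /ps /series /= (le_trans (ler_norm_sum _ _ _))//.
    apply: ler_sum => m _; rewrite normrM normrX /exp_coeff /= mulrC.
    by apply: ler_wpM2l => //; exact: exprn_ge0.
  apply: (le_trans h1); set v := `|_|.
  have v0 : 0 <= v by exact: normr_ge0.
  have h2 : series (exp_coeff v) N <= expR v.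
    apply: nondecreasing_cvgn_le; last exact: is_cvg_series_exp_coeff.
    apply/nondecreasing_seqP => m.
    by rewrite /series /= big_nat_recr//= lerDl exp_coeff_ge0.
  apply: (le_trans h2); rewrite ler_expR /v normrM; apply: ler_pM => //.
  by rewrite /absln (bigD1 i)//= lerDl; exact: sumr_ge0.
- move=> x; apply: cvgMl; apply: cvgMr; exact: cphi.
- move=> N; rewrite (_ : (fun x => _) = (fun x => \sum_(m <- index_iota 0 N)
    (c m * del ^+ m) * (h x * (momf E J a t k x * ell E ei x ^+ m)))); last first.
    by apply/funext => x; rewrite psE.
  rewrite sint_sum; last by move=> m; apply/intgZ/intg_momfM.
  rewrite big1// => m _; rewrite sintZ ?intg_momfM//.
  by rewrite (moment_polarize a0 an) ?mulr0.
Qed.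

Lemma multiplier_sin i del : i \in E -> `|del| <= a / 2 ->
  multiplier (fun x => sin (del * ln `|tnth x i|)).
Proof.
move=> iE; apply: (@multiplier_series (fun m => (odd m)%:R * (-1) ^+ m.-1./2 * (m`!%:R)^-1) sin) => //.
- move=> m; rewrite !normrM normfV !normr_nat normrX normrN normr1 expr1n mulr1.
  by case: odd; rewrite /= ?mul1r ?mul0r ?invr_ge0 ?ler0n.
- by move=> u; rewrite -sin_coeffE sin.unlock; exact: is_cvg_series_sin_coeff.
- exact: sin_max.
- by apply: continuous_measurable_fun; exact: continuous_sin.
Qed.

Lemma multiplier_cos i del : i \in E -> `|del| <= a / 2 ->
  multiplier (fun x => cos (del * ln `|tnth x i|)).
Proof.
move=> iE; apply: (@multiplier_series (fun m => (~~ odd m)%:R * (-1) ^+ m./2 * (m`!%:R)^-1) cos) => //.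
- move=> m; rewrite !normrM normfV !normr_nat normrX normrN normr1 expr1n mulr1.
  by case: odd; rewrite /= ?mul1r ?mul0r ?invr_ge0 ?ler0n.
- by move=> u; rewrite -cos_coeffE cos.unlock; exact: is_cvg_series_cos_coeff.
- exact: cos_max.
- by apply: continuous_measurable_fun; exact: continuous_cos.
Qed.

(** Limit of polynomials in g, by the iteration of [signstep]. *)
Lemma multiplier_sgr g : multiplier g -> (forall x, `|g x| <= 1) -> multiplier (fun x => Num.sg (g x)).
Proof.
move=> Dg g1; apply: (@multiplier_lim (fun k x => iter k (@signstep R) (g x)) 1).
- elim=> // k ih.
  rewrite (_ : (fun x => _) = (fun x => (3 / 2) * iter k (@signstep R) (g x) +
    (- 1 / 2) * (iter k (@signstep R) (g x) * (iter k (@signstep R) (g x) *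
       iter k (@signstep R) (g x))))).
    by apply: multiplierD; apply: multiplierZ => //; apply: multiplierM => //; exact: multiplierM.
  by apply/funext => x; rewrite iterS /signstep; ring.
- by move=> k x; exact: iter_signstep_le1.
- by move=> x; exact: iter_signstep_cvg.
Qed.

(** For fixed x, the argument del (ln |x_i| - b) lies in ]-pi, pi[ once del is
small, and there the sine has the sign of its argument. *)
Lemma multiplier_sgr_ln i b : i \in E -> multiplier (fun x => Num.sg (ln `|tnth x i| - b)).
Proof.
move=> iE; pose del k : R := a / 2 / k.+1%:R.
have del0 k : 0 < del k by rewrite !divr_gt0.
have dela k : `|del k| <= a / 2.
  rewrite gtr0_norm// /del ler_pdivrMr// ler_peMr//; first by rewrite ltW// divr_gt0.
  by rewrite ler1n.
apply: (@multiplier_lim (fun k x => Num.sg (sin (del k * (ln `|tnth x i| - b)))) 1).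
- move=> k; apply: multiplier_sgr; last by move=> x; exact: sin_max.
  rewrite (_ : (fun x => _) = (fun x => cos (del k * b) * sin (del k * ln `|tnth x i|) +
    (- sin (del k * b)) * cos (del k * ln `|tnth x i|))).
    by apply: multiplierD; apply: multiplierZ; [exact: multiplier_sin|exact: multiplier_cos].
  by apply/funext => x; rewrite mulrBr sinB; ring.
- by move=> k x; rewrite normr_sg; case: (_ != 0).
- move=> x; set w := ln _ - b; apply: cvg_near_cst; near=> k.
  have kw : a * `|w| < k%:R by near: k; exact: nbhs_infty_gtr.
  have dw : del k * `|w| < pi.
    apply: lt_le_trans (pi_ge2 R); rewrite /del mulrAC ltr_pdivrMr// -natr1.
    have -> : a / 2 * `|w| = a * `|w| / 2 by ring.
    by have := ler0n R k; lra.
  have [w0|w0|->] := ltgtP w 0; last by rewrite mulr0 sin0.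
  + rewrite ltr0_norm// in dw.
    have sp : 0 < sin (del k * - w).
      by apply: sin_gt0_pi; rewrite dw mulr_gt0// oppr_gt0.
    have -> : sin (del k * w) = - sin (del k * - w) by rewrite mulrN sinN opprK.
    by rewrite sgrN (gtr0_sg sp) ltr0_sg.
  + rewrite gtr0_norm// in dw; rewrite !gtr0_sg//.
    by apply: sin_gt0_pi; rewrite dw mulr_gt0.
Unshelve. all: by end_near. Qed.

(** Complements and finite intersections come from the algebra structure,
countable unions from bounded limits. *)
Lemma sigma_algebra_multiplier d (Y : measurableType d) (phi : Rn -> Y) :
  sigma_algebra setT [set B | measurable B /\ multiplier (fun x => \1_B (phi x))].
Proof.
have complC B : multiplier (fun x => \1_B (phi x)) -> multiplier (fun x => 1 - \1_B (phi x)).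
  move=> DB; rewrite (_ : (fun x => _) = (fun x => cst 1 x + (-1) * \1_B (phi x))).
    by apply: multiplierD; [exact: multiplier_cst | exact: multiplierZ].
  by apply/funext => x; rewrite mulN1r.
split.
- split => //; rewrite (_ : (fun x => _) = cst 0); first exact: multiplier_cst.
  by apply/funext => x; rewrite indic0.
- move=> B [mB DB]; rewrite setTD; split; first exact: measurableC.
  rewrite (_ : (fun x => _) = (fun x => 1 - \1_B (phi x))); first exact: complC.
  apply/funext => x; rewrite !indicE in_setC.
  by case: (_ \in _); rewrite ?subr0 ?subrr.
- move=> B DB; split.
    by apply: bigcupT_measurable => k; have [] := DB k.
  (* indicator function of the complement of the union of the first m sets *)
pose P m x : R := \prod_(k < m) (1 - \1_(B k) (phi x)).
  have i01 (A : set Y) (y : Y) : 0 <= 1 - \1_A y :> R /\ 1 - \1_A y <= 1 :> R.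
    by rewrite indicE; case: (_ \in _); rewrite ?subrr ?subr0.
  have P01 m x : 0 <= P m x <= 1.
    rewrite /P; apply/andP; split; first by apply: prodr_ge0 => k _; have [] := i01 (B k) (phi x).
    by apply: prodr_ile1 => k _; apply/andP; exact: i01.
  apply: (@multiplier_lim (fun m x => 1 - P m x) 1).
  + move=> m; rewrite (_ : (fun x => _) = (fun x => cst 1 x + (-1) * P m x)).
      apply: multiplierD; first exact: multiplier_cst.
      apply: multiplierZ; rewrite /P; elim: m => [|m ih].
        rewrite (_ : (fun x => _) = cst 1); first exact: multiplier_cst.
        by apply/funext => x; rewrite big_ord0.
      under eq_fun do rewrite big_ord_recr/=.
      by apply: multiplierM => //; apply: complC; have [] := DB m.
    by apply/funext => x; rewrite mulN1r.
  + by move=> m x; have /andP[? ?] := P01 m x; rewrite ger0_norm; lra.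
  + move=> x; apply: cvg_near_cst; rewrite indicE.
    have [|xB] := boolP (phi x \in \bigcup_k B k).
      rewrite inE => -[k _ Bk]; near=> m.
      have km : (k < m)%N by near: m; exact: nbhs_infty_gt.
      by rewrite /P (bigD1 (Ordinal km))//= indicE mem_set// subrr mul0r subr0.
    near=> m; rewrite /P big1 ?subrr// => k _.
    rewrite indicE memNset ?subr0// => Bk.
    by move: xB; rewrite notin_setE; apply; exists k.
Unshelve. all: by end_near. Qed.

Lemma multiplier_indic_ln i (C : set R) : i \in E -> measurable C ->
  multiplier (fun x => \1_C (ln `|tnth x i|)).
Proof.
move=> iE mC.
suff H : @measurable _ R `<=` [set B | measurable B /\
    multiplier (fun x => \1_B (ln `|tnth x i|))] by have [] := H C mC.
rewrite [X in X `<=` _](_ : _ = (@RGenOInfty.G R).-sigma.-measurable); last first.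
  exact: RGenOInfty.measurableE.
apply: smallest_sub; first exact: (@sigma_algebra_multiplier _ R (fun x => ln `|tnth x i|)).
move=> _ [b ->]; split; first exact: measurable_itv.
(* (s^2 + s) / 2 is 1 for s = 1 and 0 for s = 0 and s = -1 *)
pose s x : R := Num.sg (ln `|tnth x i| - b).
rewrite (_ : (fun x => _) = (fun x => 2^-1 * (s x * s x + s x))).
  by apply: multiplierZ; apply: multiplierD; [apply: multiplierM|]; exact: multiplier_sgr_ln.
apply/funext => x; rewrite indicE mem_setE in_itv/= andbT /s -subr_gt0.
have [w0|w0|->] := ltgtP (ln `|tnth x i| - b) 0.
- by rewrite ltr0_sg//=; lra.
- by rewrite gtr0_sg//=; lra.
- by rewrite sgr0/=; lra.
Qed.

Definition lnf x : Rn := [tuple if i \in E then ln `|tnth x i| else 0 | i < n].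

Lemma multiplier_indic_lnf (B : set Rn) : measurable B -> multiplier (fun x => \1_B (lnf x)).
Proof.
move=> mB.
suff H : @measurable _ Rn `<=` [set B | measurable B /\ multiplier (fun x => \1_B (lnf x))].
  by have [] := H B mB.
apply: smallest_sub; first exact: sigma_algebra_multiplier.
rewrite -bigcup_seq; apply: bigcup_sub => i _ _ [C mC <-].
split; first exact: measurable_tnth.
rewrite setTI; have [iE|iE] := boolP (i \in E).
  rewrite (_ : (fun x => _) = (fun x => \1_C (ln `|tnth x i|))).
    exact: multiplier_indic_ln.
  by apply/funext => x; rewrite -[LHS]/(\1_C (tnth (lnf x) i)) tnth_mktuple iE.
rewrite (_ : (fun x => _) = cst (\1_C 0)); first exact: multiplier_cst.
by apply/funext => x; rewrite -[LHS]/(\1_C (tnth (lnf x) i)) tnth_mktuple (negbTE iE).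
Qed.

(** The constant function 1 has vanishing moments by hypothesis, so that the
multiplier [multiplier_indic_lnf] applies to it. *)
Lemma moments_determine (B : set Rn) : measurable B ->
  (forall t k, moment E J a nu t k = 0) ->
  sint nu (fun x => \1_B (lnf x) * (chi E J x * expR (a * ell E (fun=> 1) x))) = 0.
Proof.
move=> mB m0; have [_ DB] := multiplier_indic_lnf mB.
have V1 : moment_free (cst 1).
  split; first exact: bmeas_cst.
  move=> t k; rewrite -(m0 t k); congr sint.
  by apply/funext => x; rewrite mul1r.
have [_ H] := DB _ V1; rewrite -(H (fun=> 0) 0%N); congr sint; apply/funext => x.
by rewrite /= mul1r /momf expr0 mulr1.
Qed.

End determinacy.

(** * A null convolution has a factor with a null component *)

Section dichotomy.
Context (R : realType) (n : nat).
Local Notation Rn := (n.-tuple R).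
Local Notation charges := ({charge set Rn -> \bar R}).
Implicit Types (nu mu : charges) (x y : Rn) (E J : {set 'I_n}).

(** The character of index J integrates to zero against nu over every Borel set
of absolute values |P_E x|: the component of index J of R_E P_E(nu), a measure
on the orthant of absolute values, is null. *)
Definition component_null E J nu := forall B, measurable B ->
  sint nu (fun x => chi E J x * \1_B (absf E x)) = 0.

Definition expf E y : Rn := [tuple if i \in E then expR (tnth y i) else 0 | i < n].

Lemma measurable_expf E : measurable_fun setT (expf E).
Proof.
apply/measurable_fun_tnthP => i; rewrite /expf.
rewrite (_ : _ \o _ = fun x : Rn => if i \in E then expR (tnth x i) else 0).
  by case: (i \in E) => //; apply: measurableT_comp => //; exact: measurable_coord.
by apply/funext => x /=; rewrite tnth_mktuple.
Qed.

Lemma measurable_lnf E : measurable_fun setT (@lnf R n E).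
Proof.
apply/measurable_fun_tnthP => i; rewrite /lnf.
rewrite (_ : _ \o _ = fun x : Rn => if i \in E then ln `|tnth x i| else 0).
  by case: (i \in E) => //; exact: measurable_lncoord.
by apply/funext => x /=; rewrite tnth_mktuple.
Qed.

Lemma lnfK E x : (forall i, i \in E -> tnth x i != 0) -> expf E (lnf E x) = absf E x.
Proof.
move=> xE; apply: eq_from_tnth => i; rewrite !tnth_mktuple.
by case: ifPn => // iE; rewrite iE lnK// posrE normr_gt0 xE.
Qed.

(** The exponents a of the weights, small enough for [weight_le] and tending to
zero; n.+1 avoids a case distinction for n = 0. *)
Definition wexp m : R := (2 * n.+1%:R * m.+1%:R)^-1.

Lemma wexp_gt0 m : 0 < wexp m.
Proof. by rewrite invr_gt0 !mulr_gt0. Qed.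

Lemma wexp_small m : 2 * wexp m * n%:R <= 1.
Proof.
have n0 : 0 <= n%:R :> R by [].
have m0 : 0 <= m%:R :> R by [].
rewrite mulrAC /wexp ler_pdivrMr ?mulr_gt0// mul1r -!natr1.
by have := mulr_ge0 n0 m0; nra.
Qed.

Lemma wexp_cvg0 : wexp m @[m --> \oo] --> (0 : R).
Proof.
rewrite (_ : wexp = (fun m => (2 * n.+1%:R)^-1 * m.+1%:R^-1)).
  rewrite -[X in _ --> X](mulr0 (2 * n.+1%:R)^-1).
  by apply: cvgMr; exact: cvg_harmonic.
by apply/funext => m; rewrite /wexp invfM.
Qed.

(** As the exponent tends to 0 the weight tends to 1 where the character does not
vanish, with 1 + |x| as a dominating function. *)
Lemma component_null_frequently E J nu : has_moment nu ->
  (forall M, exists m, (M <= m)%N /\ forall t k, moment E J (wexp m) nu t k = 0) ->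
  component_null E J nu.
Proof.
move=> nuH /choice[f fP] B mB.
pose B' : set Rn := expf E @^-1` B.
have mB' : measurable B'.
  by rewrite -[B']setTI; exact: measurable_expf.
have f_oo : f m @[m --> \oo] --> \oo.
  move=> A [N _ NA]; exists N => // m Nm; apply: NA => /=.
  by apply: leq_trans Nm _; have [] := fP m.
apply: (@sint_eq0_lim _ _ _ nu (fun m x => \1_B' (lnf E x) *
   (chi E J x * expR (wexp (f m) * ell E (fun=> 1) x))) _ (fun x => 1 + norm2 x)).
- move=> m; apply: measurable_funM.
    by apply: measurableT_comp; [exact: measurable_indic | exact: measurable_lnf].
  apply: measurable_funM; first by have [] := bmeas_chi R E J.
  by apply: measurableT_comp => //; apply: measurable_funM => //; exact: measurable_ell.
- exact: nuH.
- move=> m x; have W := weight_le E J x (ltW (wexp_gt0 (f m))) (wexp_small (f m)).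
  apply: le_trans W; rewrite normrM -[leRHS]mul1r; apply: ler_pM => //.
    by rewrite indicE; case: (_ \in _); rewrite ?normr1 ?normr0.
  rewrite normrM (ger0_norm (expR_ge0 _)); apply: ler_wpM2l => //.
  by rewrite ler_expR lerDl mulr_ge0 ?absln_ge0// ltW// wexp_gt0.
- move=> x; have [->|/chi_neq0 xE] := eqVneq (chi E J x) 0.
    by rewrite mul0r; under eq_fun do rewrite mul0r mulr0; exact: cvg_cst.
  rewrite -(lnfK xE) mulrC -[\1_B _]/(\1_B' (lnf E x)).
  apply: cvgMr; rewrite -[X in _ --> X]mulr1; apply: cvgMr.
  rewrite -[X in _ --> X](@expR0 R).
  have w0 : wexp (f m) * ell E (fun=> 1) x @[m --> \oo] --> (0 : R).
    rewrite -[X in _ --> X](mul0r (ell E (fun=> 1) x)).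
    by apply: cvgMl; exact: (cvg_comp _ _ f_oo wexp_cvg0).
  exact: (cvg_comp _ _ w0 (@continuous_expR R 0)).
- move=> m; have [_ m0] := fP m.
  exact: (moments_determine (wexp_gt0 _) (wexp_small _) nuH mB' m0).
Qed.

(** The alternative of [moment_dichotomy] may depend on the exponent, but one of
its sides holds for infinitely many exponents. *)
Lemma component_dichotomy E J nu mu : has_moment nu -> has_moment mu ->
  is_null (mconv nu mu) -> component_null E J nu \/ component_null E J mu.
Proof.
move=> nuH muH null.
have D m := moment_dichotomy E J (wexp_gt0 m) (wexp_small m) nuH muH null.
have [h|/existsNP[M hM]] := pselect (forall M, exists m, (M <= m)%N /\
    forall t k, moment E J (wexp m) nu t k = 0).
  by left; exact: component_null_frequently.
right; apply: component_null_frequently => // N; exists (maxn M N); split.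
  exact: leq_maxr.
have [h|//] := D (maxn M N); exfalso; apply: hM; exists (maxn M N).
by split => //; exact: leq_maxl.
Qed.

End dichotomy.

(** * Fourier analysis on the group of signs *)

Section sign_patterns.
Context (R : realType) (n : nat).
Local Notation Rn := (n.-tuple R).
Local Notation pattern := {ffun 'I_n -> bool}.
Local Notation charges := ({charge set Rn -> \bar R}).
Implicit Types (nu mu : charges) (x y : Rn) (E J D : {set 'I_n}) (f g : pattern).

Definition supported D f := [forall i, f i ==> (i \in D)].

Definition sgp J f : R := \prod_(j in J) (-1) ^+ f j.

Definition flip f x : Rn := [tuple (-1) ^+ f i * tnth x i | i < n].

(** Sign patterns are boolean functions rather than subsets so that the group law
is the exclusive or. *)
Definition xorf f g : pattern := [ffun i => f i (+) g i].

Definition negs E x : pattern := [ffun i => (i \in E) && (tnth x i < 0)].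

Lemma xorfK g : involutive (xorf^~ g).
Proof. by move=> f; apply/ffunP => i; rewrite !ffunE addbK. Qed.

Lemma supported_xorf D f g : supported D g -> supported D (xorf f g) = supported D f.
Proof.
move=> /forallP Dg.
have H h : supported D h -> supported D (xorf h g).
  move=> /forallP Dh; apply/forallP => i; rewrite ffunE; apply/implyP.
  move: (Dg i) (Dh i); case: (g i); case: (h i) => //=.
by apply/idP/idP => [/H|/H//]; rewrite xorfK.
Qed.

Lemma sgp_xorf J f g : sgp J (xorf f g) = sgp J f * sgp J g.
Proof.
by rewrite /sgp -big_split/=; apply: eq_bigr => j _; rewrite ffunE signr_addb.
Qed.

Lemma sgp_sqr J f : sgp J f * sgp J f = 1.
Proof.
rewrite -sgp_xorf /sgp big1// => j _; by rewrite ffunE addbb.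
Qed.

Lemma measurable_flip f : measurable_fun setT (flip f).
Proof.
apply/measurable_fun_tnthP => i; rewrite /flip.
rewrite (_ : _ \o _ = fun x : Rn => (-1) ^+ f i * tnth x i).
  by apply: measurable_funM => //; exact: measurable_coord.
by apply/funext => x /=; rewrite tnth_mktuple.
Qed.

Lemma measurable_projflip E f : measurable_fun setT (fun x => projf E (flip f x)).
Proof.
apply: measurableT_comp; [exact: measurable_projf | exact: measurable_flip].
Qed.

Lemma chi_split E J x :
  chi E J x = chi E finset.set0 x * \prod_(j in J) Num.sg (tnth x j).
Proof. by rewrite /chi big_set0 mulr1. Qed.

Lemma chi_id E x : (forall i, i \in E -> tnth x i != 0) -> chi E finset.set0 x = 1.
Proof. by move=> xE; rewrite /chi big_set0 mulr1 big1// => i /xE ->. Qed.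

Lemma sgp_negs J E x : J \subset E -> (forall i, i \in E -> tnth x i != 0) ->
  sgp J (negs E x) = \prod_(j in J) Num.sg (tnth x j).
Proof.
move=> JE xE; apply: eq_bigr => j jJ; have jE := fintype.subsetP JE j jJ.
rewrite ffunE jE/=; have := xE j jE.
by have [x0|x0|->] := ltgtP (tnth x j) 0; rewrite ?eqxx// => _;
  [rewrite ltr0_sg|rewrite gtr0_sg].
Qed.

Lemma projf_flip_negs E f x : projf E (flip (xorf f (negs E x)) x) = flip f (absf E x).
Proof.
apply: eq_from_tnth => i; rewrite !tnth_mktuple; case: ifPn => iE; last by rewrite mulr0.
rewrite !ffunE iE/= signr_addb -mulrA; congr (_ * _).
have [x0|x0] := ltP (tnth x i) 0; first by rewrite mulN1r ltr0_norm.
by rewrite mul1r ger0_norm.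
Qed.

Lemma supported_negs E D x : E \subset D -> supported D (negs E x).
Proof.
move=> ED; apply/forallP => i; rewrite ffunE; apply/implyP => /andP[iE _].
exact: (fintype.subsetP ED).
Qed.

(** Translating the sign patterns by that of x, which brings x to the orthant of
the absolute values, multiplies the sum by the character at x. *)
Lemma twisted_sum E J D (F : Rn -> R) x : J \subset E -> E \subset D ->
  chi E finset.set0 x * \sum_(f | supported D f) sgp J f * F (projf E (flip f x)) =
  chi E J x * \sum_(f | supported D f) sgp J f * F (flip f (absf E x)).
Proof.
move=> JE ED; have [c0|/chi_neq0 xE] := eqVneq (chi E finset.set0 x) 0.
  by rewrite (chi_split E J) c0 !mul0r.
rewrite (chi_split E J) -mulrA; congr (_ * _).
rewrite (reindex_inj (inv_inj (xorfK (negs E x))))/= big_distrr/=.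
rewrite (eq_bigl (supported D)); last first.
  by move=> f; rewrite supported_xorf// supported_negs.
apply: eq_bigr => f _; rewrite projf_flip_negs sgp_xorf sgp_negs//.
by rewrite mulrCA mulrA mulrAC -mulrA mulrCA.
Qed.

(** Up to a positive factor, the set function delta_(D, J) * R_E P_E(nu) is null.
The parameter D covers both D = [n] and D = E = J. *)
Definition twisted_null E J D nu := forall A : set Rn, measurable A ->
  sint nu (fun x => chi E finset.set0 x *
    \sum_(f | supported D f) sgp J f * \1_A (projf E (flip f x))) = 0.

Lemma bmeas_sum_cond I (r : seq I) (P : pred I) (F : I -> Rn -> R) :
  (forall i, bmeas (F i)) -> bmeas (fun x => \sum_(i <- r | P i) F i x).
Proof. by move=> bF; under eq_fun do rewrite -big_filter; exact: bmeas_sum. Qed.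

Lemma component_null_fun E J nu (F : Rn -> R) : component_null E J nu -> bmeas F ->
  sint nu (fun x => chi E J x * F (absf E x)) = 0.
Proof.
move=> Z bF.
have L0 := @bfunctional0 _ Rn R.
exact: (bfunctional_ext (bfunctional_sint nu (bmeas_chi R E J) (@measurable_absf R n E)) L0).
Qed.

Lemma sint_twisted E J D nu (F : Rn -> R) : bmeas F ->
  sint nu (fun x => chi E finset.set0 x *
    \sum_(f | supported D f) sgp J f * F (projf E (flip f x))) =
  \sum_(f | supported D f) sgp J f *
    sint nu (fun x => chi E finset.set0 x * F (projf E (flip f x))).
Proof.
move=> bF; have bc := bmeas_chi R E finset.set0.
have bFf f : bmeas (fun x => chi E finset.set0 x * F (projf E (flip f x))).
  by apply: bmeasM => //; apply: bmeas_comp => //; exact: measurable_projflip.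
rewrite -[RHS]big_filter.
under [RHS]eq_bigr do rewrite -sintZ ?intg_finite//.
rewrite -sint_sum; last by move=> f; apply/intg_finite/bmeasZ.
congr sint; apply/funext => x; rewrite big_filter big_distrr/=.
by apply: eq_bigr => f _; rewrite mulrCA.
Qed.

Lemma twisted_null_fun E J D nu (F : Rn -> R) : twisted_null E J D nu -> bmeas F ->
  sint nu (fun x => chi E finset.set0 x *
    \sum_(f | supported D f) sgp J f * F (projf E (flip f x))) = 0.
Proof.
move=> Z bF.
have L0 := @bfunctional0 _ Rn R.
rewrite sint_twisted//.
have bL : bfunctional (fun G : Rn -> R =>
   \sum_(f <- [seq f <- index_enum pattern | supported D f]) sgp J f *
      sint nu (fun x => chi E finset.set0 x * G (projf E (flip f x)))).
  apply: bfunctional_sum => f; apply: bfunctional_scale.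
  by apply: bfunctional_sint; [exact: bmeas_chi | exact: measurable_projflip].
rewrite -big_filter.
apply: (bfunctional_ext bL L0 _ bF) => A mA.
by rewrite big_filter -sint_twisted ?Z//; exact: bmeas_indic.
Qed.

(** For the converse, the sum is tested on y |-> sgn_J(y) 1_B(|y|), which the
character of the sum untwists: all terms become equal. *)
Lemma component_nullP E J D nu : J \subset E -> E \subset D ->
  component_null E J nu <-> twisted_null E J D nu.
Proof.
move=> JE ED; split=> [Z A mA|Z B mB].
  under [X in sint nu X]eq_fun do rewrite twisted_sum//.
  apply: (@component_null_fun _ _ _ (fun y => \sum_(f | supported D f) sgp J f * \1_A (flip f y))) => //.
  apply: bmeas_sum_cond => f; apply: bmeasZ; apply: bmeas_comp.
    exact: measurable_flip.
  exact: bmeas_indic.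
(* the index set0 in chi keeps only the product of the signs *)
pose F y : R := chi finset.set0 J y * \1_B (absf E y).
have bF : bmeas F.
  apply: bmeasM; first exact: bmeas_chi.
  by apply: bmeas_comp; [exact: measurable_absf | exact: bmeas_indic].
have := twisted_null_fun Z bF.
have FE f x : F (projf E (flip f x)) =
    sgp J f * (\prod_(j in J) Num.sg (tnth x j) * \1_B (absf E x)).
  rewrite /F /chi big_set0 mul1r mulrA; congr (_ * \1_B _).
    rewrite /sgp -big_split/=; apply: eq_bigr => j jJ.
    rewrite !tnth_mktuple (fintype.subsetP JE j jJ) sgrM.
    by case: (f j); rewrite ?expr1 ?expr0 ?sgrN ?sgr1.
  apply: eq_from_tnth => i; rewrite !tnth_mktuple; case: (boolP (i \in E)) => // iE.
  by rewrite normrM normrX normrN1 expr1n mul1r.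
pose K : R := \sum_(f | supported D f) 1.
have K0 : K != 0.
  rewrite gt_eqF// /K (bigD1 [ffun=> false])/=; last first.
    by apply/forallP => i; rewrite ffunE.
  by rewrite ltr_pwDl// sumr_ge0.
rewrite (_ : (fun x => _) = (fun x => K * (chi E J x * \1_B (absf E x)))); last first.
  apply/funext => x; rewrite (chi_split E J) -[in RHS]mulrA [RHS]mulrCA; congr (_ * _).
  rewrite /K big_distrl/=; apply: eq_bigr => f _.
  by rewrite FE mulrA sgp_sqr.
rewrite sintZ; last first.
  apply/intg_finite/bmeasM; first exact: bmeas_chi.
  by apply: bmeas_comp; [exact: measurable_absf | exact: bmeas_indic].
by move=> /eqP; rewrite mulf_eq0 (negbTE K0) => /eqP.
Qed.

End sign_patterns.

(** * Convolution with the atomic measures delta *)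

Section delta_convolution.
Context (R : realType) (n : nat).
Local Notation Rn := (n.-tuple R).
Local Notation pattern := {ffun 'I_n -> bool}.
Local Notation charges := ({charge set Rn -> \bar R}).
Implicit Types (nu mu : charges) (x y : Rn) (E J D : {set 'I_n}) (f g : pattern).

Definition svec D f : Rn := [tuple if i \in D then (-1) ^+ f i else 0 | i < n].

Lemma cmul_svec D f y : cmul (svec D f) y = projf D (flip f y).
Proof.
apply: eq_from_tnth => i; rewrite !tnth_mktuple.
by case: ifP => // _; rewrite mul0r.
Qed.

Lemma sign_vectors_svec D :
  sign_vectors D = [set svec D f | f in [set f | supported D f]].
Proof.
apply/seteqP; split=> [s sD|_ [f _ <-] j].
  exists [ffun i => tnth s i == -1].
    apply/forallP => i; rewrite ffunE; apply/implyP; have := sD i.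
    by case: ifP => // _ ->; rewrite eq_sym oppr_eq0 oner_eq0.
  apply: eq_from_tnth => i; rewrite tnth_mktuple ffunE; have := sD i.
  case: ifP => // _ [->|->]; first by rewrite eqxx expr1.
  by rewrite -subr_eq0 opprK -mulr2n pnatr_eq0 expr0.
rewrite tnth_mktuple; case: (boolP (j \in D)) => // _.
by case: (f j); [left; rewrite expr1 | right; rewrite expr0].
Qed.

Lemma svec_inj D : set_inj [set f | supported D f] (svec D).
Proof.
move=> f g; rewrite !inE => /forallP/= fD /forallP/= gD fg.
apply/ffunP => i; have := congr1 (fun x => tnth x i) fg.
rewrite !tnth_mktuple; have := fD i; have := gD i.
case: ifP => [_ _ _|_]; last by case: (f i); case: (g i).
move=> /eqP; case: (f i); case: (g i) => //.
- by rewrite expr1 expr0 -subr_eq0 -opprD oppr_eq0 -mulr2n pnatr_eq0.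
- by rewrite expr1 expr0 -subr_eq0 opprK -mulr2n pnatr_eq0.
Qed.

Lemma sint_delta D J (F : Rn -> R) : J \subset D -> bmeas F ->
  sint (delta D J) F =
  2 ^- #|D| * \sum_(f | supported D f) sgp R J f * F (svec D f).
Proof.
move=> JD bF.
have bL : bfunctional (fun F : Rn -> R => 2 ^- #|D| *
    \sum_(f <- [seq f <- index_enum pattern | supported D f]) sgp R J f * F (svec D f)).
  apply: bfunctional_scale; apply: bfunctional_sum => f; apply: bfunctional_scale.
  exact: bfunctional_eval.
rewrite -[in RHS]big_filter.
apply: (bfunctional_ext (bfunctional_sint_id _) bL _ bF) => A mA.
apply: EFin_inj; rewrite sint_indic// /delta EFinM; congr (_ * _)%E.
rewrite sign_vectors_svec fsbig_image; last exact: svec_inj.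
rewrite (_ : [set f | supported D f] =
    [set` [seq f <- index_enum pattern | supported D f]]); last first.
  by apply/seteqP; split=> f /=; rewrite mem_filter mem_index_enum andbT.
rewrite -fsbig_seq; last by rewrite filter_uniq// index_enum_uniq.
rewrite -sumEFin; apply: eq_bigr => f _.
rewrite EFinM diracE indicE; congr (_%:E * _)%E.
rewrite /sgp; apply: eq_bigr => j jJ.
by rewrite tnth_mktuple (fintype.subsetP JD j jJ).
Qed.

Lemma mconv_delta D J nu (A : set Rn) : J \subset D -> measurable A ->
  mconv (delta D J) nu A = (2 ^- #|D| * \sum_(f | supported D f) sgp R J f *
    sint nu (fun y => \1_A (projf D (flip f y))))%:E.
Proof.
move=> JD mA.
have b1 : bmeas (fun z : Rn * Rn => \1_A (cmul z.1 z.2) : R).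
  by apply: (bmeas_comp (@measurable_cmul R n)); exact: bmeas_indic.
rewrite mconv_sint// sint_delta//; last exact: (bmeas_sint_prod nu nu b1).
congr (_ * _)%:E; apply: eq_bigr => f _; congr (_ * sint nu _).
by apply/funext => y; rewrite cmul_svec.
Qed.

(** The hypothesis states that mu and R_E P_E(nu) agree on the functions that
occur in the convolution. *)
Lemma null_twisted D E J nu mu : J \subset D ->
  (forall f (A : set Rn), measurable A ->
    sint mu (fun y => \1_A (projf D (flip f y))) =
    sint nu (fun x => chi E finset.set0 x * \1_A (projf E (flip f x)))) ->
  is_null (mconv (delta D J) mu) <-> twisted_null E J D nu.
Proof.
move=> JD H.
have E1 (A : set Rn) : measurable A -> mconv (delta D J) mu A = (2 ^- #|D| *
  sint nu (fun x => chi E finset.set0 x *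
    \sum_(f | supported D f) sgp R J f * \1_A (projf E (flip f x))))%:E.
  move=> mA; rewrite mconv_delta// sint_twisted//; last exact: bmeas_indic.
  by congr (_ * _)%:E; apply: eq_bigr => f _; rewrite H.
split=> null A mA; have := null A mA; rewrite E1//; last by rewrite null// mulr0.
move=> [] /eqP; rewrite mulf_eq0 invr_eq0 expf_eq0/= pnatr_eq0 andbF/=.
by move=> /eqP.
Qed.

Lemma indic_stratum E x : \1_(stratum E) (projf E x) = chi E finset.set0 x :> R.
Proof.
have [c0|/chi_neq0 xE] := eqVneq (chi E finset.set0 x) 0.
  rewrite c0 indicE memNset// => sE; move: c0; rewrite chi_id => [/eqP|i iE].
    by rewrite oner_eq0.
  by have /(_ iE) := (sE i).2; rewrite tnth_mktuple iE.
rewrite chi_id// indicE mem_set// => i; rewrite tnth_mktuple.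
by case: ifP => [iE|]; [split => // _; exact: xE | rewrite eqxx].
Qed.

Lemma flip_projf E f x : flip f (projf E x) = projf E (flip f x).
Proof.
by apply: eq_from_tnth => i; rewrite !tnth_mktuple; case: ifP; rewrite ?mulr0.
Qed.

Lemma projf_setT x : projf [set: 'I_n]%SET x = x.
Proof. by apply: eq_from_tnth => i; rewrite tnth_mktuple finset.in_setT. Qed.

Lemma null_restr_proj E J nu : J \subset E ->
  is_null (mconv (delta [set: 'I_n]%SET J) (restr_charge E (proj_charge E nu))) <->
  component_null E J nu.
Proof.
move=> JE; rewrite (component_nullP nu JE (finset.subsetT E)).
apply: null_twisted => [|f A mA]; first exact: finset.subsetT.
have bA : bmeas (\1_A : Rn -> R) by exact: bmeas_indic.
rewrite /restr_charge sint_crestr; last first.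
  by apply: (bmeas_comp (@measurable_projflip R n _ f)).
rewrite /proj_charge sint_image; last first.
  apply: bmeasM; first by apply: bmeas_indic; exact: measurable_stratum.
  by apply: (bmeas_comp (@measurable_projflip R n _ f)).
by congr sint; apply/funext => x; rewrite indic_stratum projf_setT flip_projf.
Qed.

Lemma null_restr J nu :
  is_null (mconv (delta [set: 'I_n]%SET J) (restr_charge [set: 'I_n]%SET nu)) <->
  component_null [set: 'I_n]%SET J nu.
Proof.
rewrite (component_nullP nu (finset.subsetT J) (finset.subsetT _)).
apply: null_twisted => [|f A mA]; first exact: finset.subsetT.
have bA : bmeas (\1_A : Rn -> R) by exact: bmeas_indic.
rewrite /restr_charge sint_crestr; last first.
  by apply: (bmeas_comp (@measurable_projflip R n _ f)).
by congr sint; apply/funext => x; rewrite -indic_stratum !projf_setT.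
Qed.

Lemma null_delta_self J nu :
  (forall F : Rn -> R, bmeas F -> sint nu F = sint nu (fun x => chi J finset.set0 x * F x)) ->
  is_null (mconv (delta J J) nu) <-> component_null J J nu.
Proof.
move=> H; rewrite (component_nullP nu (subxx _) (subxx _)).
apply: null_twisted => // f A mA; rewrite H//.
by apply: (bmeas_comp (@measurable_projflip R n _ f)); exact: bmeas_indic.
Qed.

End delta_convolution.

(** * A measure annihilated by a nonuniversal one *)

Section witness.
Context (R : realType) (n : nat).
Local Notation Rn := (n.-tuple R).
Local Notation pattern := {ffun 'I_n -> bool}.
Local Notation charges := ({charge set Rn -> \bar R}).
Variables (E J : {set 'I_n}) (JE : J \subset E) (Jeven : ~~ odd #|J|).
Implicit Types (nu mu : charges) (x y : Rn) (f g K : pattern) (p : pattern * pattern).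

Definition dil K x : Rn := [tuple 2 ^+ K i * tnth x i | i < n].

(** The first pattern gives the signs of the atom, the second one tells which of
its coordinates are of absolute value 2 rather than 1; with [weight] these are
the atoms of delta_(E, J) convolved with the product over i in E of
delta_1 - delta_2.  Sign patterns and dilations run over all coordinates, which
only repeats each atom. *)
Definition atom p : Rn :=
  [tuple if i \in E then (-1) ^+ p.1 i * 2 ^+ p.2 i else 0 | i < n].

Definition weight p : R := sgp R J p.1 * sgp R E p.2.

Lemma measurable_dil K : measurable_fun setT (dil K).
Proof.
apply/measurable_fun_tnthP => i; rewrite /dil.
rewrite (_ : _ \o _ = fun x : Rn => 2 ^+ K i * tnth x i).
  by apply: measurable_funM => //; exact: measurable_coord.
by apply/funext => x /=; rewrite tnth_mktuple.
Qed.

Lemma cmul_atom x p : cmul x (atom p) = dil p.2 (projf E (flip p.1 x)).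
Proof.
apply: eq_from_tnth => i; rewrite !tnth_mktuple.
by case: ifP => // _; rewrite ?mulr0//; ring.
Qed.

(** Dilating a coordinate that is zero does nothing, so that the two terms of
delta_1 - delta_2 in this coordinate cancel. *)
Lemma dilation_sum (F : Rn -> R) y i : i \in E -> tnth y i = 0 ->
  \sum_K sgp R E K * F (dil K y) = 0.
Proof.
move=> iE yi0; pose d : pattern := [ffun j => j == i].
have sd : sgp R E d = -1.
  rewrite /sgp (bigD1 i)//= ffunE eqxx expr1 big1 ?mulr1// => j /andP[_ /negbTE ji].
  by rewrite ffunE ji.
have dd K : dil (xorf K d) y = dil K y.
  apply: eq_from_tnth => j; rewrite !tnth_mktuple !ffunE.
  by have [->|_] := eqVneq j i; [rewrite yi0 !mulr0 | rewrite addbF].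
set S := \sum_K _; have : S = - S.
  rewrite {1}/S (reindex_inj (inv_inj (xorfK d)))/= /S -sumrN.
  by apply: eq_bigr => K _; rewrite sgp_xorf sd dd mulrN1 mulNr.
by lra.
Qed.

Lemma weighted_sum (F : Rn -> R) x :
  \sum_p weight p * F (cmul x (atom p)) = \sum_K sgp R E K *
    (chi E finset.set0 x * \sum_(f | supported [set: 'I_n]%SET f)
      sgp R J f * F (dil K (projf E (flip f x)))).
Proof.
have E1 : \sum_p weight p * F (cmul x (atom p)) =
    \sum_f sgp R J f * \sum_K sgp R E K * F (dil K (projf E (flip f x))).
  under [RHS]eq_bigr do rewrite big_distrr.
  rewrite pair_bigA/=; apply: eq_bigr => p _; rewrite /weight cmul_atom; ring.
have sT (f : pattern) : supported [set: 'I_n]%SET f.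
  by apply/forallP => i; rewrite finset.in_setT implybT.
rewrite E1; have [c0|/chi_neq0 xE] := eqVneq (chi E finset.set0 x) 0.
  rewrite c0 [RHS]big1 => [|K _]; last by rewrite mul0r mulr0.
  rewrite big1// => f _.
  have [i iE xi0] : exists2 i, i \in E & tnth x i = 0.
    apply: contrapT => nx; move: c0; rewrite chi_id => [/eqP|i iE].
      by rewrite oner_eq0.
    by apply/eqP => xi0; apply: nx; exists i.
  rewrite (dilation_sum F iE) ?mulr0// !tnth_mktuple iE xi0 mulr0//.
rewrite chi_id//.
under [RHS]eq_bigr do rewrite mul1r big_distrr/=.
under [LHS]eq_bigr do rewrite big_distrr/=.
rewrite exchange_big/=; apply: eq_bigr => K _; apply: eq_big => f; first by rewrite sT.
by rewrite mulrCA.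
Qed.

Lemma witness_charge : exists c : charges,
  forall F : Rn -> R, bmeas F -> sint c F = \sum_p weight p * F (atom p).
Proof.
have [c cE] := sum_of_charges (index_enum _) (fun p : pattern * pattern =>
  cscale (weight p) (charge_of_finite_measure (\d_(atom p) : {finite_measure set Rn -> \bar R}))).
exists c => F bF.
have bL : bfunctional (fun F : Rn -> R => \sum_p weight p * F (atom p)).
  by apply: bfunctional_sum => p; apply: bfunctional_scale; exact: bfunctional_eval.
apply: (bfunctional_ext (bfunctional_sint_id _) bL _ bF) => A mA.
apply: EFin_inj; rewrite sint_indic// cE -sumEFin; apply: eq_bigr => p _.
by rewrite EFinM.
Qed.

Lemma tv_eq0 (c : charges) N : measurable N ->
  (forall B, measurable B -> B `<=` N -> c B = 0%E) -> tv c N = 0%E.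
Proof.
move=> mN cN.
rewrite /tv /= /charge_variation /= !jordan_posE !jordan_negE !cjordan_posE !cjordan_negE.
rewrite /crestr0 !mem_set// /crestr.
have mP := measurable_hahn_pos c; have mNg := measurable_hahn_neg c.
by rewrite !cN ?oppe0 ?adde0//; (exact: measurableI || exact: subIsetl).
Qed.

Lemma has_moment_bounded (c : charges) (M : R) :
  tv c (~` [set x | norm2 x <= M]) = 0%E ->
  (\int[Defs.total_variation c]_x (norm2 x)%:E < +oo)%E.
Proof.
set B := [set x | _]; move=> cB.
have mB : measurable B.
  rewrite -[B]setTI (_ : B = (@norm2 R n) @^-1` [set` `]-oo, M]]).
    by apply: measurable_norm2.
  by apply/seteqP; split=> y; rewrite /B /= in_itv.
have mF : measurable_fun setT (fun x : Rn => norm2 x * \1_B x).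
  by apply: measurable_funM; [exact: measurable_norm2 | exact: measurable_indic].
rewrite (@ge0_ae_eq_integral _ _ _ _ _ _ (fun x => (norm2 x * \1_B x)%:E))//.
- apply: integrable_lty => //.
  suff : intg (tv c) (fun x => norm2 x * \1_B x) by [].
  apply: intg_finite; split => //; exists `|M| => x.
  rewrite indicE; have [xB|xB] := boolP (x \in B); last by rewrite mulr0 normr0.
  rewrite mulr1 ger0_norm ?norm2_ge0//.
  by move: xB; rewrite inE => xB; rewrite (le_trans xB)// ler_norm.
- by apply/measurable_EFinP; exact: measurable_norm2.
- by apply/measurable_EFinP.
- by move=> x _; rewrite lee_fin norm2_ge0.
- by move=> x _; rewrite lee_fin mulr_ge0// norm2_ge0.
exists (~` B); split => //; first exact: measurableC.
move=> x /= /not_implyP[_ nx] xB; apply: nx.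
by rewrite indicE mem_set// mulr1.
Qed.

(** By [weighted_sum] the convolution of nu with the witness is a combination of
images of R_E P_E(nu) twisted by the character, all null.  The witness is
symmetric because |J| is even, and it is not null because only positive weights
occur at the point whose coordinates in E are 1. *)
Lemma not_universal nu (A : set Rn) : measurable A -> stratum E `<=` A ->
  component_null E J nu -> ~ universal_on (int_sym_charges A) nu.
Proof.
move=> mA EA Z U; have [c cE] := witness_charge.
have mconv0 : is_null (mconv nu c).
  move=> B mB; rewrite mconv_sint//.
  have bx x : bmeas (fun y => \1_B (cmul x y) : R).
    by apply: bmeas_comp; [exact: measurable_cmulr | exact: bmeas_indic].
  under [X in sint nu X]eq_fun do rewrite cE ?weighted_sum//.
  have bK K : bmeas (\1_B \o dil K : Rn -> R).
    by apply: bmeas_comp; [exact: measurable_dil | exact: bmeas_indic].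
  have bT K : bmeas (fun x => chi E finset.set0 x * \sum_(f | supported [set: 'I_n]%SET f)
      sgp R J f * \1_B (dil K (projf E (flip f x)))).
    apply: bmeasM; first exact: bmeas_chi.
    apply: bmeas_sum_cond => f; apply: bmeasZ.
    apply: (bmeas_comp (phi := fun x => projf E (flip f x)) _ (bK K)).
    exact: measurable_projflip.
  rewrite sint_sum; last by move=> K; apply: intg_finite; exact: bmeasZ.
  rewrite big1// => K _; rewrite sintZ; last exact: intg_finite.
  have TN := (component_nullP nu JE (finset.subsetT E)).1 Z.
  by rewrite (twisted_null_fun TN (bK K)) mulr0.
have atomE p : stratum E (atom p).
  move=> i; rewrite tnth_mktuple; case: ifP => iE; last by rewrite eqxx.
  by split=> // _; rewrite mulf_neq0// expf_neq0// ?oppr_eq0 ?oner_eq0 ?pnatr_eq0.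
have csupp N : measurable N -> (forall p, ~ N (atom p)) -> c N = 0%E.
  move=> mN hN; rewrite -sint_indic// cE; last exact: bmeas_indic.
  by rewrite big1// => p _; rewrite indicE memNset ?mulr0.
have tvN N : measurable N -> (forall p, ~ N (atom p)) -> tv c N = 0%E.
  move=> mN hN; apply: tv_eq0 => // B mB BN; apply: csupp => // p /BN; exact: hN.
have Ac : int_sym_charges A c.
  split; first split.
  - apply: tvN; first exact: measurableC.
    by move=> p; apply; apply: EA; exact: atomE.
  - apply: (@has_moment_bounded _ (\sum_p norm2 (atom p))); apply: tvN.
      rewrite -[X in measurable (~` X)]setTI.
      rewrite (_ : mkset _ = (@norm2 R n) @^-1` [set` `]-oo, \sum_p norm2 (atom p)]]).
        by apply: measurableC; apply: measurable_norm2.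
      by apply/seteqP; split=> y; rewrite /= in_itv.
    move=> p; apply => /=; rewrite (bigD1 p)//= lerDl.
    by apply: sumr_ge0 => q _; exact: norm2_ge0.
  - move=> B mB; rewrite -!sint_indic//.
    have bB : bmeas (\1_B : Rn -> R) by exact: bmeas_indic.
    rewrite /refl_charge sint_image// !cE//; last first.
      by apply: bmeas_comp => //; exact: measurable_reflf.
    congr (_%:E); pose o : pattern := [ffun=> true].
    (* changing all signs permutes the atoms, and preserves the weights since |J|
   is even *)
have inj : injective (fun p : pattern * pattern => (xorf p.1 o, p.2)).
      move=> [f K] [f' K'] [ff' ->]; congr (_, _).
      exact: (inv_inj (xorfK o)).
    rewrite (reindex_inj inj)/=; apply: eq_bigr => p _.
    have so : sgp R J o = 1.
      rewrite /sgp (eq_bigr (fun=> -1)); last by move=> j _; rewrite ffunE.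
      by rewrite prodr_const -signr_odd (negbTE Jeven).
    rewrite /weight/= sgp_xorf so mulr1; congr (_ * \1_B _).
    apply: eq_from_tnth => i; rewrite !tnth_mktuple finset.in_setT !ffunE/=.
    case: ifP => _; last by rewrite oppr0.
    by rewrite addbT signrN mulNr opprK.
have c0 := U c Ac mconv0.
(* an atom in B has trivial patterns on E, hence weight 1 *)
pose B : set Rn := \bigcap_(i in [set i | i \in E]) [set x | tnth x i = 1].
have mB : measurable B.
  apply: fin_bigcap_measurable => // i _.
  rewrite (_ : [set x | _] = (fun x : Rn => tnth x i) @^-1` [set 1%R])//.
  rewrite -[X in measurable X]setTI.
  exact: (@measurable_coord R n i measurableT _ (measurable_set1 1%R)).
have := c0 B mB; rewrite -sint_indic// cE; last exact: bmeas_indic.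
have term_ge0 p : 0 <= weight p * \1_B (atom p) :> R.
  rewrite indicE; have [|_] := boolP (atom p \in B); last by rewrite mulr0.
  rewrite inE mulr1 => pB.
  have pE i : i \in E -> p.1 i = false /\ p.2 i = false.
    move=> iE; have := pB i iE; rewrite /= tnth_mktuple iE.
    case: (p.1 i); case: (p.2 i) => //; rewrite ?expr1 ?expr0 ?mul1r ?mulr1 => h; exfalso; lra.
  rewrite /weight /sgp !big1 ?mulr1// => i iE; first by rewrite (pE i iE).2.
  by rewrite (pE i (fintype.subsetP JE i iE)).1.
pose p0 : pattern * pattern := ([ffun=> false], [ffun=> false]).
rewrite (bigD1 p0)//= => -[] H.
have w0 : weight p0 * \1_B (atom p0) = 1 :> R.
  rewrite /weight /sgp !big1; try by move=> i _; rewrite ffunE.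
  rewrite indicE mem_set ?mulr1// => i /= iE.
  by rewrite tnth_mktuple iE !ffunE !expr0 mulr1.
have : 0 <= \sum_(p | p != p0) weight p * \1_B (atom p) :> R by apply: sumr_ge0.
by move: H; rewrite w0 => H; lra.
Qed.

End witness.

(** * Symmetric measures with null even components *)

Section sufficiency.
Context (R : realType) (n : nat).
Local Notation Rn := (n.-tuple R).
Local Notation pattern := {ffun 'I_n -> bool}.
Local Notation charges := ({charge set Rn -> \bar R}).
Implicit Types (nu mu : charges) (x y : Rn) (E J G : {set 'I_n}) (f g h : pattern).

Lemma sint_ext nu mu (F : Rn -> R) : (forall A, measurable A -> nu A = mu A) ->
  bmeas F -> sint nu F = sint mu F.
Proof.
move=> H bF; apply: (bfunctional_ext (bfunctional_sint_id nu) (bfunctional_sint_id mu)) => // A mA.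
by apply: EFin_inj; rewrite !sint_indic// H.
Qed.

Lemma reflf_flip G x : reflf G x = flip [ffun i => i \in G] x.
Proof.
apply: eq_from_tnth => i; rewrite !tnth_mktuple ffunE.
by case: ifP; rewrite ?expr1 ?mulN1r ?expr0 ?mul1r.
Qed.

Lemma chi_flip E J f x : chi E J (flip f x) = sgp R J f * chi E J x.
Proof.
rewrite /chi mulrCA; congr (_ * _).
  by apply: eq_bigr => i _; rewrite tnth_mktuple mulf_eq0 signr_eq0.
rewrite /sgp -big_split/=; apply: eq_bigr => j _; rewrite tnth_mktuple sgrM.
by case: (f j); rewrite ?expr1 ?expr0 ?sgrN sgr1.
Qed.

Lemma absf_flip E f x : absf E (flip f x) = absf E x.
Proof.
apply: eq_from_tnth => i; rewrite !tnth_mktuple.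
by rewrite normrM normrX normrN1 expr1n mul1r.
Qed.

Definition component_test E J (B : set Rn) x : R := chi E J x * \1_B (absf E x).

Lemma bmeas_component_test E J B : measurable B -> bmeas (component_test E J B).
Proof.
move=> mB; apply: bmeasM; first exact: bmeas_chi.
by apply: bmeas_comp; [exact: measurable_absf | exact: bmeas_indic].
Qed.

Lemma even_under_projP E G nu : even_under G (proj_charge E nu) ->
  forall F : Rn -> R, bmeas F ->
  sint nu (fun x => F (reflf G (projf E x))) = sint nu (fun x => F (projf E x)).
Proof.
move=> ev F bF.
have bG : bmeas (fun x : Rn => F (reflf G x)).
  by apply: bmeas_comp => //; exact: measurable_reflf.
rewrite -(sint_image (measurable_projf E) nu bG) -(sint_image (measurable_projf E) nu bF).
rewrite -(sint_image (measurable_reflf G) _ bF).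
exact: sint_ext.
Qed.

Lemma even_underP G nu : even_under G nu ->
  forall F : Rn -> R, bmeas F -> sint nu (fun x => F (reflf G x)) = sint nu F.
Proof.
move=> ev F bF; rewrite -(sint_image (measurable_reflf G) _ bF); exact: sint_ext.
Qed.

(** A character of odd index changes sign under x |-> - x. *)
Lemma component_null_odd E J mu : symmetric_charge mu -> odd #|J| -> component_null E J mu.
Proof.
move=> sym oddJ B mB; have bF := bmeas_component_test E J mB.
suff : sint mu (component_test E J B) = 0 by [].
have := even_underP sym bF.
rewrite (_ : (fun x => _) = (fun x => (-1) * component_test E J B x)).
  by rewrite sintZ ?intg_finite//; lra.
apply/funext => x; rewrite /component_test reflf_flip absf_flip chi_flip -mulrA; congr (_ * _).
rewrite /sgp (eq_bigr (fun=> -1)); last by move=> j _; rewrite ffunE finset.in_setT.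
by rewrite prodr_const -signr_odd oddJ expr1.
Qed.

Lemma prod_1D_supported E (u : 'I_n -> R) :
  \prod_(i in E) (1 + u i) = \sum_(h | supported E h) \prod_(i in [set i | h i]%SET) u i.
Proof.
(* v kills the subsets that are not contained in E *)
pose v i := if i \in E then u i else 0.
transitivity (\prod_i \sum_(b : bool) (if b then v i else 1)).
  rewrite big_mkcond/=; apply: eq_bigr => i _; rewrite big_bool/= /v.
  by case: ifP => _; rewrite ?add0r// addrC.
rewrite bigA_distr_bigA [RHS]big_mkcond/=; apply: eq_bigr => h _.
case: ifP => [/forallP hE|/negbT].
  rewrite [RHS]big_mkcond/=; apply: eq_bigr => i _; rewrite inE /v.
  by have := hE i; case: (h i) => //= ->.
rewrite negb_forall => /existsP[i]; rewrite negb_imply => /andP[hi iE].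
by rewrite (bigD1 i)//= hi /v (negbTE iE) mul0r.
Qed.

Lemma supported_subset E h : supported E h -> [set i | h i]%SET \subset E.
Proof.
move=> /forallP hE; apply/fintype.subsetP => i; rewrite inE => hi.
exact: (implyP (hE i)).
Qed.

(** Fourier inversion: the product over i in E of 1 + s_i sgn x_i is 2^|E| when s is
the sign pattern of x on E, and zero otherwise. *)
Lemma character_sum E (F : Rn -> R) x :
  2 ^+ #|E| * (chi E finset.set0 x * F (projf E x)) =
  \sum_(h | supported E h) \sum_(f | supported E f)
    sgp R [set i | h i]%SET f * (chi E [set i | h i]%SET x * F (flip f (absf E x))).
Proof.
have [c0|/chi_neq0 xE] := eqVneq (chi E finset.set0 x) 0.
  rewrite c0 mul0r mulr0 big1// => h _; rewrite big1// => f _.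
  by rewrite chi_split c0 !mul0r mulr0.
rewrite exchange_big/=.
transitivity (\sum_(f | supported E f) F (flip f (absf E x)) *
    \prod_(i in E) (1 + (-1) ^+ f i * (-1) ^+ (negs E x) i)); last first.
  apply: eq_bigr => f _; rewrite prod_1D_supported big_distrr/=; apply: eq_bigr => h hE.
  rewrite chi_split chi_id// mul1r -(sgp_negs (supported_subset hE) xE).
  by rewrite big_split/= [RHS]mulrA mulrC.
have negsS : supported E (negs E x) by exact: supported_negs.
rewrite (bigD1 (negs E x))//= [X in _ + X]big1 ?addr0.
  rewrite chi_id// mul1r mulrC; congr (_ * _).
    congr F; rewrite -projf_flip_negs; congr projf.
    apply: eq_from_tnth => i; rewrite !tnth_mktuple ffunE addbb expr0.
    by rewrite mul1r.
  rewrite (eq_bigr (fun=> 2)) ?prodr_const// => i _.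
  by rewrite -signr_addb addbb expr0.
move=> f /andP[fE fN].
have [i iE fi] : exists2 i, i \in E & f i != (negs E x) i.
  apply: contrapT => nx; move/negP: fN; apply; apply/eqP/ffunP => i.
  have [iE|iE] := boolP (i \in E); first by apply/eqP/negP => /negP h; apply: nx; exists i.
  have := forallP fE i; rewrite (negbTE iE) implybF => /negbTE ->.
  by rewrite ffunE (negbTE iE).
rewrite (bigD1 i)//= -signr_addb; move: fi; rewrite -addbN.
by case: (f i); case: (negs E x i) => //= _; rewrite expr1 subrr mul0r mulr0.
Qed.

Lemma components_null E mu : (forall J, J \subset E -> component_null E J mu) ->
  forall F : Rn -> R, bmeas F -> sint mu (fun x => chi E finset.set0 x * F (projf E x)) = 0.
Proof.
move=> Z F bF.
have bS : bmeas (fun x => chi E finset.set0 x * F (projf E x)).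
  apply: bmeasM; first exact: bmeas_chi.
  by apply: bmeas_comp => //; exact: measurable_projf.
have : 2 ^+ #|E| * sint mu (fun x => chi E finset.set0 x * F (projf E x)) = 0.
  rewrite -sintZ; last exact: intg_finite.
  under [X in sint mu X]eq_fun do rewrite character_sum.
  have bT J f : bmeas (fun x => sgp R J f * (chi E J x * F (flip f (absf E x)))).
    apply/bmeasZ/bmeasM; first exact: bmeas_chi.
    exact: (bmeas_comp (@measurable_absf R n E) (bmeas_comp (@measurable_flip R n f) bF)).
  under [X in sint mu X]eq_fun do rewrite -big_filter.
  rewrite sint_sum => [|h]; last by apply: intg_finite; apply: bmeas_sum_cond => f; exact: bT.
  rewrite big_filter big1// => h hE.
  under [X in sint mu X]eq_fun do rewrite -big_filter.
  rewrite sint_sum => [|f]; last by apply: intg_finite; exact: bT.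
  rewrite big1// => f _.
  have bF' := bmeas_comp (@measurable_flip R n f) bF.
  rewrite sintZ; last first.
    apply/intg_finite/bmeasM; first exact: bmeas_chi.
    exact: (bmeas_comp (@measurable_absf R n E) bF').
  by rewrite (component_null_fun (Z _ (supported_subset hE)) bF') mulr0.
by move=> /eqP; rewrite mulf_eq0 expf_eq0 pnatr_eq0 andbF => /eqP.
Qed.

Lemma stratum_sum E x : chi E finset.set0 x = \sum_(G : {set 'I_n} | E \subset G) \1_(stratum G) x :> R.
Proof.
pose S := [set i | tnth x i != 0]%SET.
have SG G : \1_(stratum G) x = (G == S)%:R :> R.
  rewrite indicE; congr (nat_of_bool _)%:R; apply/idP/eqP => [|->]; rewrite inE.
    by move=> xG; apply/setP => i; rewrite inE; apply/idP/idP => /xG.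
  by move=> i; rewrite inE.
under eq_bigr do rewrite SG.
have [ES|ES] := boolP (E \subset S).
  rewrite (bigD1 S)//= eqxx big1 ?addr0 => [|G /andP[_ /negbTE ->]//].
  by rewrite chi_id// => i iE; have := fintype.subsetP ES i iE; rewrite inE.
rewrite big1 => [|G EG].
  apply/eqP; apply: contraNT ES => /chi_neq0 xE.
  by apply/fintype.subsetP => i iE; rewrite inE xE.
by case: eqP => // GS; move: ES; rewrite -GS EG.
Qed.

(** R_E P_E(mu) is the sum of the projections of the parts of mu on the strata of
index G containing E.  If the parts with G different from E are null, what
remains is the part of index E itself; hence the downward induction. *)
Lemma strata_null mu :
  (forall E (F : Rn -> R), bmeas F ->
     sint mu (fun x => chi E finset.set0 x * F (projf E x)) = 0) ->
  is_null mu.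
Proof.
move=> H.
have bS G (F : Rn -> R) : bmeas F -> bmeas (fun x => \1_(stratum G) x * F x).
  by move=> bF; apply: bmeasM => //; apply: bmeas_indic; exact: measurable_stratum.
have Q k E : (n - #|E| < k)%N -> forall F : Rn -> R, bmeas F ->
    sint mu (fun x => \1_(stratum E) x * F x) = 0.
  elim: k E => [//|k ih] E Ek F bF; have := H E F bF.
  have bp : bmeas (fun x => F (projf E x)).
    by apply: bmeas_comp => //; exact: measurable_projf.
  under [X in sint mu X]eq_fun do rewrite stratum_sum big_distrl/= -big_filter.
  rewrite sint_sum => [|G]; last by apply: intg_finite; exact: bS.
  rewrite big_filter (bigD1 E)//= [X in _ + X]big1 => [|G /andP[EG GE]]; last first.
    apply: (ih G _ _ bp); apply: leq_trans (ltn_sub2l _ _) _; last exact: Ek.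
    - rewrite -[X in (_ < X)%N]card_ord; apply: leq_trans (max_card G).
      by apply: proper_card; rewrite finset.properEneq eq_sym GE.
    - by apply: proper_card; rewrite finset.properEneq eq_sym GE.
  rewrite addr0 => <-; congr sint; apply/funext => x; rewrite indicE.
  have [|_] := boolP (x \in stratum E); last by rewrite !mul0r.
  rewrite inE => xE; congr (_ * F _); apply: eq_from_tnth => i; rewrite tnth_mktuple.
  case: ifPn => // iE; apply/eqP; apply: contraNT iE => xi.
  exact/(xE i).
move=> A mA; rewrite -sint_indic//.
have bA : bmeas (\1_A : Rn -> R) by exact: bmeas_indic.
have -> : (\1_A : Rn -> R) =
    (fun x => \sum_(G <- index_enum {set 'I_n}) \1_(stratum G) x * \1_A x).
  apply/funext => x; rewrite -big_distrl/=.
  have := stratum_sum finset.set0 x; rewrite chi_id => [S1|i]; last by rewrite inE.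
  rewrite (eq_bigl (fun G : {set 'I_n} => finset.set0 \subset G)).
    by rewrite -S1 mul1r.
  by move=> G; rewrite finset.sub0set.
rewrite sint_sum => [|G]; last by apply: intg_finite; exact: bS.
by rewrite big1// => G _; apply: (Q n.+1) => //; rewrite ltnS leq_subr.
Qed.

End sufficiency.

(** * Characterizations of universality *)

Section universality.
Context (R : realType) (n : nat).
Local Notation Rn := (n.-tuple R).
Local Notation pattern := {ffun 'I_n -> bool}.
Local Notation charges := ({charge set Rn -> \bar R}).
Implicit Types (nu mu : charges) (x y : Rn) (E J G : {set 'I_n}) (f g h : pattern).

Lemma int_charges_moment A nu : int_charges A nu -> has_moment nu.
Proof.
move=> [_ nuoo]; apply: intgD; first by apply: intg_finite; exact: bmeas_cst.
apply/integrableP; split; first by apply/measurable_EFinP; exact: measurable_norm2.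
by under eq_integral do rewrite /= (ger0_norm (norm2_ge0 _)).
Qed.

Lemma components_null_conv E nu mu :
  has_moment nu -> has_moment mu -> symmetric_charge mu ->
  (forall J, J \subset E -> ~~ odd #|J| -> ~ component_null E J nu) ->
  is_null (mconv nu mu) ->
  forall F : Rn -> R, bmeas F -> sint mu (fun x => chi E finset.set0 x * F (projf E x)) = 0.
Proof.
move=> nuH muH sym nuE null; apply: components_null => J JE.
have [oddJ|evenJ] := boolP (odd #|J|); first exact: component_null_odd.
by have [/(nuE J JE evenJ)|] := component_dichotomy E J nuH muH null.
Qed.

Lemma universal_stratum nu : has_moment nu ->
  universal_on (int_sym_charges (stratum [set: 'I_n]%SET)) nu <->
  (forall J, ~~ odd #|J| -> ~ component_null [set: 'I_n]%SET J nu).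
Proof.
move=> nuH; split=> [U J evenJ Z|H mu [muA sym] null].
  exact: (@not_universal _ _ [set: 'I_n]%SET J (finset.subsetT J) evenJ nu _
    (@measurable_stratum _ _ _) (fun _ z => z) Z U).
have V := components_null_conv nuH (int_charges_moment muA) sym (fun J _ => H J) null.
apply/is_nullP => F bF; rewrite -[RHS](V F bF).
have mS : measurable (stratum [set: 'I_n]%SET : set Rn) by exact: measurable_stratum.
apply: (@sint_eq_off_null _ _ _ mu (~` stratum [set: 'I_n]%SET)) => //.
- exact: measurableC.
- by have [] := muA.
- apply: bmeasM; first exact: bmeas_chi.
  by apply: bmeas_comp => //; exact: measurable_projf.
- move=> x /contrapT xS; rewrite projf_setT chi_id ?mul1r// => i _.
  by apply/(xS i); rewrite finset.in_setT.
Qed.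

Lemma universal_all nu : has_moment nu ->
  universal_on (int_sym_charges [set: Rn]) nu <->
  (forall J E, J \subset E -> ~~ odd #|J| -> ~ component_null E J nu).
Proof.
move=> nuH; split=> [U J E JE evenJ Z|H mu [muA sym] null].
  exact: (@not_universal _ _ E J JE evenJ nu _ measurableT (fun _ _ => Logic.I) Z U).
apply: strata_null => E.
apply: (components_null_conv nuH (int_charges_moment muA) sym _ null) => J.
exact: H.
Qed.

(** The complement of the open stratum is the union of the other strata. *)
Lemma of_order_ae nu E (F : Rn -> R) : of_order [set: 'I_n]%SET nu -> bmeas F ->
  sint nu F = sint nu (fun x => chi E finset.set0 x * F x).
Proof.
move=> [_ nu0] bF.
pose N : set Rn := ~` stratum [set: 'I_n]%SET.
have mN : measurable N by apply: measurableC; exact: measurable_stratum.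
have N0 : tv nu N = 0%E.
  have iS G : intg (tv nu) (\1_(stratum G)).
    by apply/intg_finite/bmeas_indic; exact: measurable_stratum.
  have -> : tv nu N = (\int[tv nu]_x \1_N x)%:E.
    by rewrite /Rintegral integral_indic// setIT fineK// fin_num_measure.
  congr EFin.
  have -> : \int[tv nu]_x \1_N x = \int[tv nu]_x
      (\sum_(G <- [seq G : {set 'I_n} <- index_enum _ | G != [set: 'I_n]%SET])
        \1_(stratum G) x).
    apply: eq_Rintegral => x _; rewrite big_filter.
    have -> : \1_N x = 1 - \1_(stratum [set: 'I_n]%SET) x :> R.
      by rewrite !indicE in_setC; case: (_ \in _); rewrite ?subr0 ?subrr.
    have := stratum_sum finset.set0 x; rewrite chi_id => [S1|i]; last by rewrite inE.
    rewrite [X in X - _]S1 (bigD1 [set: 'I_n]%SET)/=; last exact: finset.sub0set.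
    rewrite addrAC subrr add0r; apply: eq_bigl => G.
    by rewrite finset.sub0set.
  rewrite Rintegral_sum// big_filter big1// => G GT.
  rewrite /Rintegral integral_indic//; last exact: measurable_stratum.
  by rewrite setIT; have := nu0 G GT => ->.
apply: (@sint_eq_off_null _ _ _ nu N) => //.
  by apply: bmeasM => //; exact: bmeas_chi.
move=> x /contrapT xS; rewrite chi_id ?mul1r// => i _.
by apply/(xS i); rewrite finset.in_setT.
Qed.

(** Off a null set the character and the absolute values of index J are functions
of those of index E. *)
Lemma component_null_self E J nu : of_order [set: 'I_n]%SET nu -> J \subset E ->
  component_null E J nu -> component_null J J nu.
Proof.
move=> ord JE Z B mB.
have bF : bmeas (fun y : Rn => \1_B (projf J y) : R).
  by apply: bmeas_comp; [exact: measurable_projf | exact: bmeas_indic].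
rewrite (of_order_ae E ord (bmeas_component_test J J mB)) -[RHS](component_null_fun Z bF).
rewrite [RHS](of_order_ae E ord); last first.
  apply: bmeasM; first exact: bmeas_chi.
  exact: (bmeas_comp (@measurable_absf R n E) bF).
congr sint; apply/funext => x.
have [->|/chi_neq0 xE] := eqVneq (chi E finset.set0 x) 0; first by rewrite !mul0r.
have xJ i : i \in J -> tnth x i != 0 by move=> /(fintype.subsetP JE); exact: xE.
rewrite /component_test (chi_split J J) (chi_split E J) !chi_id// !mul1r.
congr (_ * \1_B _); apply: eq_from_tnth => i; rewrite !tnth_mktuple.
by have [/(fintype.subsetP JE) ->|] := boolP (i \in J).
Qed.

Lemma universal_of_order nu : has_moment nu -> of_order [set: 'I_n]%SET nu ->
  universal_on (int_sym_charges [set: Rn]) nu <->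
  (forall J, ~~ odd #|J| -> ~ component_null J J nu).
Proof.
move=> nuH ord; rewrite universal_all//; split=> [H J|H J E JE evenJ Z].
  exact: H.
exact: (H J evenJ (component_null_self ord JE Z)).
Qed.

(** T_G reverses exactly one of the two coordinates i, j, hence changes the sign of
their character, while it preserves P_E(nu). *)
Lemma even_under_component_null E G i j nu : i \in G -> j \in E -> j \notin G ->
  G \subset E -> even_under G (proj_charge E nu) ->
  component_null [set i; j]%SET [set i; j]%SET nu.
Proof.
move=> iG jE jG GE ev B mB.
have ij : i != j by apply: contraNneq jG => <-.
set J := [set i; j]%SET.
have JE : J \subset E.
  by apply/fintype.subsetP => k; rewrite !inE => /orP[/eqP->|/eqP->//]; exact: (fintype.subsetP GE).
have bF := bmeas_component_test J J mB.
have pE x : component_test J J B (projf E x) = component_test J J B x.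
  have Ek k : k \in J -> tnth (projf E x) k = tnth x k.
    by move=> kJ; rewrite tnth_mktuple (fintype.subsetP JE).
  rewrite /component_test /chi; congr (_ * _ * \1_B _); try by apply: eq_bigr => k /Ek ->.
  apply: eq_from_tnth => k; rewrite ![tnth (absf _ _) _]tnth_mktuple.
  by case: ifP => // /Ek ->.
suff : sint nu (component_test J J B) = 0 by [].
have := even_under_projP ev bF.
under [X in _ = sint nu X]eq_fun do rewrite pE.
rewrite (_ : (fun x => _) = (fun x => (-1) * component_test J J B x)).
  by rewrite sintZ ?intg_finite//; lra.
apply/funext => x; rewrite -(pE x) /component_test reflf_flip absf_flip chi_flip -mulrA.
congr (_ * _); rewrite /sgp (big_setD1 i)/=; last by rewrite !inE eqxx.
rewrite ffunE iG expr1 (_ : (J :\ i)%SET = [set j]%SET).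
  by rewrite big_set1 ffunE (negbTE jG) expr0 mulr1.
apply/setP => k; rewrite !inE; have [->|] := eqVneq k i => //=.
by rewrite (negbTE ij).
Qed.

End universality.

Theorem theorem7p13 (R : realType) (n : nat) (hn : (1 <= n)%N)
  (nu : {charge set (n.-tuple R) -> \bar R})
  (hnu : int_charges [set: n.-tuple R] nu) :
  [/\ universal_on (int_sym_charges (stratum [set: 'I_n]%SET)) nu <->
      (forall J : {set 'I_n}, ~~ odd #|J| ->
        ~ is_null (mconv (delta [set: 'I_n]%SET J)
                         (restr_charge [set: 'I_n]%SET nu))),
      universal_on (int_sym_charges [set: n.-tuple R]) nu <->
      (forall J E : {set 'I_n}, J \subset E -> ~~ odd #|J| ->
        ~ is_null (mconv (delta [set: 'I_n]%SET J)
                         (restr_charge E (proj_charge E nu)))) &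
      of_order [set: 'I_n]%SET nu ->
      (universal_on (int_sym_charges [set: n.-tuple R]) nu <->
       (forall J : {set 'I_n}, ~~ odd #|J| ->
         ~ is_null (mconv (delta J J) nu))) /\
      (universal_on (int_sym_charges [set: n.-tuple R]) nu ->
       forall E G : {set 'I_n}, G \subset E ->
         even_under G (proj_charge E nu) -> G = finset.set0 \/ G = E)].
Proof.
have nuH := int_charges_moment hnu.
split.
- rewrite universal_stratum//.
  by split=> H J evenJ; have := H J evenJ; rewrite null_restr.
- rewrite universal_all//.
  by split=> H J E JE evenJ; have := H J E JE evenJ; rewrite null_restr_proj.
move=> ord; split.
  rewrite universal_of_order//; split=> H J evenJ; have := H J evenJ;
  rewrite null_delta_self// => F bF; exact: of_order_ae.
rewrite universal_of_order// => H E G GE ev.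
have [->|/finset.set0Pn[i iG]] := eqVneq G finset.set0; first by left.
right; apply/eqP; rewrite finset.eqEsubset GE/=; apply/fintype.subsetP => j jE.
apply: contrapT => /negP jG.
apply: (H [set i; j]%SET); last exact: even_under_component_null iG jE jG GE ev.
have ij : i != j by apply: contraNneq jG => <-.
by rewrite cards2 ij.
Qed.
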